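(* Let $X \subset \mathbf{P}^3$ be a projective integral surface of degree $d \ge 3$. Let $x \in X$ be a point of multiplicity $m$ on $X$, and suppose that $X$ contains no line passing through $x$. Then: (a) $$\epsilon(\mathcal{O}_X(1),x) \ge \frac{d}{d-1}.$$ (b) If $\epsilon(\mathcal{O}_X(1),x) < \frac{m+1}{m}$, then $$\epsilon(\mathcal{O}_X(1),x) = \frac{a}{b}$$ for some integers $a,b$ such that $3 \le a \le md$ and $\frac{ma}{m+1} < b \le \frac{a(d-1)}{d}$.
   Context: Varieties are over the field $\mathbf{C}$ of complex numbers; ''integral'' means reduced and irreducible (so $X$ may be singular). $\mathcal{O}_X(1)$ denotes the restriction to $X$ of the hyperplane bundle $\mathcal{O}_{\mathbf{P}^3}(1)$. Seshadri constant: for a projective variety $X$, a nef line bundle $L$ on $X$ and a point $x \in X$, let $\pi:\widetilde{X}\to X$ be the blowup of $X$ at $x$ with exceptional divisor $E$. The Seshadri constant of $L$ at $x$ is $\epsilon(L,x) := \sup\{\alpha \ge 0 \mid \pi^*L - \alpha E \text{ is nef}\}$. Equivalently, $\epsilon(L,x) = \inf_{x\in C\subset X} \frac{L\cdot C}{\mathrm{mult}_x C}$, where the infimum is over all integral curves $C\subset X$ passing through $x$ and $\mathrm{mult}_x C$ is the multiplicity of $C$ at $x$. *)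

(* Defs.v *)
From mathcomp Require Import all_boot all_order all_algebra.
From mathcomp Require Import complex classical_sets reals mpoly.
(* The notations of these two files are incompatible with those of mpoly. *)
From mathcomp Require Import -(notations) constructive_ereal ereal.

Set Implicit Arguments.
Unset Strict Implicit.
Unset Printing Implicit Defensive.

Import Order.TTheory GRing.Theory Num.Theory.
Local Open Scope ring_scope.
Local Open Scope classical_set_scope.

Section LinearAlgebra.
Variables (K : fieldType) (n : nat).
Implicit Types A B I J : set {mpoly K[n]}.

(* dim_K (A / (A `&` B)) = r, for K-subspaces A and B: some r elements of A
   form a basis modulo B. *)
Definition quotient_dim A B (r : nat) : Prop :=
  exists2 v : 'I_r -> {mpoly K[n]}, (forall i, A (v i)) &
    forall p, A p -> exists! c : 'rV[K]_r, B (p - \sum_i c 0 i *: v i).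

Definition ideal_add I J : set {mpoly K[n]} :=
  [set h | exists f g, [/\ I f, J g & h = f + g]].

Definition ideal_mul I J : set {mpoly K[n]} :=
  [set h | exists2 s : seq ({mpoly K[n]} * {mpoly K[n]}),
      (forall u, u \in s -> I u.1 /\ J u.2) & h = \sum_(u <- s) u.1 * u.2].

Definition ideal_exp I (k : nat) : set {mpoly K[n]} :=
  iter k (ideal_mul I) setT.

Definition vanishing_ideal (W : set 'rV[K]_n) : set {mpoly K[n]} :=
  [set f | forall v : 'rV[K]_n, W v -> f.@[v 0] = 0].

End LinearAlgebra.

(* A function nat -> nat, given by its graph h, agrees with the polynomial P
   at all large integers; such a P is unique. *)
Definition eventually_poly (h : nat -> nat -> Prop) (P : {poly rat}) : Prop :=
  exists k0 : nat, forall k : nat, (k0 <= k)%N ->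
    exists2 r : nat, h k r & P.[k%:R] = r%:R.

(* r! times the leading coefficient, where r is the degree of P. *)
Definition normalized_lead (P : {poly rat}) : rat :=
  ((size P).-1)`!%:R * lead_coef P.

Section ProjectiveVarieties.
Variables (K : fieldType) (n : nat).

(* A subset of P^n is represented by the set of all homogeneous coordinate
   vectors of its points, a subset of K^(n+1) \ {0}. *)
Implicit Types V C L : set 'rV[K]_n.+1.

Definition zero_locus (T : set {mpoly K[n.+1]}) : set 'rV[K]_n.+1 :=
  [set v : 'rV[K]_n.+1 | v != 0 /\ forall f, T f -> f.@[v 0] = 0].

Definition closed_subset V : Prop :=
  exists2 T : set {mpoly K[n.+1]},
    (forall f, T f -> exists t : nat, f \is t.-homog) & V = zero_locus T.

Definition integral_variety V : Prop :=
  [/\ closed_subset V, V !=set0 &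
      forall A B, closed_subset A -> closed_subset B ->
        V `<=` A `|` B -> V `<=` A \/ V `<=` B].

(* The Hilbert function t |-> dim (S / I(V))_t, with S = K[x_0, ..., x_n]. *)
Definition hilbert_function V (t r : nat) : Prop :=
  quotient_dim [set f : {mpoly K[n.+1]} | f \is t.-homog]
    (vanishing_ideal V) r.

Definition has_dim V (r : nat) : Prop :=
  exists2 P, eventually_poly (hilbert_function V) P & size P = r.+1.

(* For V of dimension 1 this is the intersection number O(1) . V. *)
Definition has_degree V (d : nat) : Prop :=
  exists2 P, eventually_poly (hilbert_function V) P & normalized_lead P = d%:R.

Definition integral_curve C : Prop := integral_variety C /\ has_dim C 1.
Definition integral_surface V : Prop := integral_variety V /\ has_dim V 2.

Definition is_line L : Prop :=
  exists2 A : 'M[K]_(2, n.+1), \rank A = 2 &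
    L = [set v : 'rV[K]_n.+1 | v != 0 /\ (v <= A)%MS].

(* V `&` {x_i != 0}, realized as an affine algebraic set in the hyperplane
   x_i = 1 of K^(n+1). *)
Definition affine_chart V (i : 'I_n.+1) : set 'rV[K]_n.+1 :=
  [set v : 'rV[K]_n.+1 | V v /\ v 0 i = 1].

Definition maximal_ideal (p : 'rV[K]_n.+1) : set {mpoly K[n.+1]} :=
  vanishing_ideal [set p].

(* k |-> dim O_{V,x} / m_x^k.  With W the chart x_i = 1, p the representative
   of x in W and M the maximal ideal of polynomials vanishing at p, this
   quotient is K[x_0, ..., x_n] / (I(W) + M^k), which is already local. *)
Definition hilbert_samuel V (x : 'rV[K]_n.+1) (i : 'I_n.+1) (k r : nat)
    : Prop :=
  quotient_dim setT
    (ideal_add (vanishing_ideal (affine_chart V i))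
               (ideal_exp (maximal_ideal ((x 0 i)^-1 *: x)) k)) r.

(* The multiplicity of the local ring O_{V,x}; it does not depend on i. *)
Definition has_multiplicity V (x : 'rV[K]_n.+1) (m : nat) : Prop :=
  exists i : 'I_n.+1, x 0 i != 0 /\
    exists2 P, eventually_poly (hilbert_samuel V x i) P &
      normalized_lead P = m%:R.

End ProjectiveVarieties.

(* epsilon(O_X(1), x), the infimum of (O_X(1) . C) / mult_x C over the integral
   curves C through x contained in X. *)
Definition seshadri_O1 (R : realType) (n : nat)
    (X : set 'rV[R[i]]_n.+1) (x : 'rV[R[i]]_n.+1)
    : extended R :=
  ereal_inf [set e | exists C, exists a b : nat,
    [/\ integral_curve C, C `<=` X /\ C x, has_degree C a,
        has_multiplicity C x b
      & e = EFin (a%:R / b%:R)]].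

(* Main.v *)
From HB Require Import structures.
Require Import Defs.
From mathcomp Require Import all_boot all_order all_algebra.
From mathcomp Require Import boolp ring lra zify.
From mathcomp Require Import complex classical_sets reals mpoly.
From mathcomp Require Import -(notations) constructive_ereal ereal.

Set Implicit Arguments.
Unset Strict Implicit.
Unset Printing Implicit Defensive.

Import Order.TTheory GRing.Theory Num.Theory.
Local Open Scope ring_scope.
Local Open Scope classical_set_scope.

(** Let F = 0 be the equation of X, and let w = x_i be a coordinate that does not
    vanish at x. Write F = sum_l w^(e - l) F_l, where F_l is a form of degree l
    in the coordinates of the projective space of lines through x
    (expands_at_homog). Let G_j = sum_(l <= j) w^(j - l) F_l be the truncations.
    On X, the form G_j agrees up to a power of w with minus the terms of order
    greater than j, so that it vanishes at x to order j + 1, one more than its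
    degree (truncation_jet). If an integral curve C through x on X does not lie
    on G_j = 0, Bezout gives (j + 1) mult_x C <= j deg C (curve_bezout).

    For (a): if C lay on G_j = 0 for all j < e, all the F_l would vanish on C,
    and the line joining x to another point of C would lie on X. So the
    inequality holds for some j <= d - 1 (curve_degree_multiplicity).

    For (b): let mu be the least index with F_mu <> 0. It is at most m, and
    F_mu = G_mu. So a curve with deg C / mult_x C < (m + 1) / m lies on
    F = F_mu = 0, and its degree is at most md (curve_degree_bound). Hence there
    are finitely many ratios below (m + 1) / m, the infimum is one of them, and
    the remaining bounds on a and b are (a) and the choice of the ratio.

    As degrees and multiplicities are read off Hilbert and Hilbert-Samuel
    functions, Bezout is proved by counting dimensions. Multiplication by a form
    G of degree j embeds S_t / I(C) into S_(t + j) / I(C), and raises the order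
    at x by j + 1 if G vanishes to that order; this bounds the differences
    P(k + j + 1) - P(k) of the Hilbert-Samuel polynomial of C by j deg C
    (bezout_count). So P has degree at most 1 (bounded_differences), and it is
    not constant by Nakayama's lemma (jets_not_stationary).

    The degree and the multiplicity of X are those of F, because the ideal of X
    is generated by a prime element (surface_principal). Indeed polynomial rings
    are factorial (factorial_mpoly), so that the ideal contains a prime element
    F, and an element that F does not divide would make the Hilbert function of
    X grow at most linearly (complete_intersection_bound). Counting the multiples
    of F among forms and among jets then gives deg F <= d (surface_degree_le) and
    mu <= m (surface_multiplicity_ge). *)

(** * Factorial rings and the Gauss lemma *)

Section Factoriality.
Implicit Type R : idomainType.

Definition divides R (a b : R) : Prop := exists c, b = a * c.

Definition prime_element R (p : R) : Prop :=
  [/\ p != 0, p \isn't a GRing.unit &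
      forall a b, divides p (a * b) -> divides p a \/ divides p b].

Definition prime_factorization R (a : R) : Prop :=
  exists u s, [/\ u \is a GRing.unit, forall p, p \in s -> prime_element p
    & a = u * \prod_(p <- s) p].

Definition factorial_ring R : Prop := forall a : R, a != 0 -> prime_factorization a.

Lemma divides_mulr R (p a b : R) : divides p a -> divides p (a * b).
Proof. by case=> c ->; exists (c * b); rewrite mulrA. Qed.

Lemma divides_mull R (p a b : R) : divides p a -> divides p (b * a).
Proof. by rewrite mulrC; exact: divides_mulr. Qed.

Lemma dividesD R (p a b : R) : divides p a -> divides p b -> divides p (a + b).
Proof. by case=> c -> [d ->]; exists (c + d); rewrite mulrDr. Qed.

Lemma dividesB R (p a b : R) : divides p a -> divides p b -> divides p (a - b).
Proof. by case=> c -> [d ->]; exists (c - d); rewrite mulrBr. Qed.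

Lemma divides_sum R (p : R) (I : Type) (r : seq I) (P : pred I) (F : I -> R) :
  (forall i, P i -> divides p (F i)) -> divides p (\sum_(i <- r | P i) F i).
Proof.
move=> pF; apply: big_ind => //; first by exists 0; rewrite mulr0.
exact: dividesD.
Qed.

Lemma prime_not_divides_unit R (p u : R) :
  prime_element p -> u \is a GRing.unit -> ~ divides p u.
Proof.
case=> _ /negP pU _ uU [c uE]; apply: pU.
by move: uU; rewrite uE unitrM => /andP[].
Qed.

Lemma prime_divides_prod R (p u : R) (s : seq R) :
    prime_element p -> u \is a GRing.unit -> divides p (u * \prod_(q <- s) q) ->
  exists2 q, q \in s & divides p q.
Proof.
move=> pp uU; elim: s => [|q s IH].
  by rewrite big_nil mulr1 => /(prime_not_divides_unit pp uU).
rewrite big_cons mulrCA; case: (pp) => _ _ h /h[pq|/IH[q' q's pq']].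
  by exists q => //; rewrite mem_head.
by exists q' => //; rewrite inE q's orbT.
Qed.

Lemma prime_divides_prime R (p q : R) :
  prime_element p -> prime_element q -> divides p q ->
  exists2 v, v \is a GRing.unit & q = p * v.
Proof.
case=> p0 pU _ [q0 _ qP] [v qE]; exists v => //.
have [[w pE]|[w vE]]: divides q p \/ divides q v by apply: qP; exists 1; rewrite mulr1.
  apply/unitrP; exists w; rewrite [v * w]mulrC.
  suff -> : w * v = 1 by [].
  by apply: (mulfI q0); rewrite mulrA -pE mulr1.
case/negP: pU; apply/unitrP; exists w; rewrite [p * w]mulrC.
suff -> : w * p = 1 by [].
by apply: (mulfI q0); rewrite mulr1 [RHS]qE vE [w * p]mulrC mulrCA.
Qed.

(** The number of factors drops: this bounds how often a prime can be divided
    out of a polynomial, by looking at its leading coefficient. *)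
Lemma divide_factorization R (p b u : R) (s : seq R) :
    prime_element p -> u \is a GRing.unit ->
    (forall q, q \in s -> prime_element q) -> p * b = u * \prod_(q <- s) q ->
  exists u' s', [/\ u' \is a GRing.unit, forall q, q \in s' -> prime_element q,
    b = u' * \prod_(q <- s') q & (size s' < size s)%N].
Proof.
move=> pp uU sP pbE.
have [q qs pq] : exists2 q, q \in s & divides p q.
  by apply: (prime_divides_prod pp uU); exists b.
have [v vU qE] := prime_divides_prime pp (sP _ qs) pq.
exists (u * v), (rem q s); split.
- by rewrite unitrM uU.
- by move=> r /mem_rem; exact: sP.
- have p0 : p != 0 by case: pp.
  apply: (mulfI p0); rewrite pbE (big_rem q) //= {1}qE.
  by rewrite [in RHS]mulrA [p * (u * v)]mulrCA -!mulrA.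
- by rewrite size_rem // prednK //; case: (s) qs.
Qed.

Lemma divides_polyC R (p : R) (f : {poly R}) :
  divides p%:P f <-> forall i, divides p f`_i.
Proof.
split=> [[g ->] i|h]; first by rewrite coefCM; exists g`_i.
have /choice[c cE] : forall i, exists c, f`_i = p * c by [].
exists (\poly_(i < size f) c i); apply/polyP => i.
rewrite coefCM coef_poly; case: ltnP => // /leq_sizeP fi.
by rewrite fi // mulr0.
Qed.

(** If p divides neither f nor g, then in the coefficient of f * g whose index
    is the sum of the lowest indices at which p fails to divide the coefficients
    of f and of g, exactly one term is not divisible by p. *)
Lemma prime_polyC R (p : R) : prime_element p -> prime_element p%:P.
Proof.
case=> p0 pU pP; split; rewrite ?polyC_eq0 //.
  by rewrite poly_unitE coefC eqxx size_polyC p0 /=.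
move=> f g /divides_polyC pfg; apply: contrapT => /not_orP[].
move=> /divides_polyC/existsNP[i0 fi0] /divides_polyC/existsNP[j0 gj0].
have ex (h : {poly R}) k0 : ~ divides p h`_k0 ->
    exists k, ~ divides p h`_k /\ forall l, (l < k)%N -> divides p h`_l.
  move=> hk0; have ex1 : exists k, `[< ~ divides p h`_k >] by exists k0; apply/asboolP.
  case: (ex_minnP ex1) => k /asboolP hk kmin; exists k; split=> // l lk.
  apply: contrapT => hl; have := kmin l; rewrite leqNgt lk => /(_ _)/negP.
  by apply => //; apply/asboolP.
have [i [fi fl]] := ex _ _ fi0; have [j [gj gl]] := ex _ _ gj0.
have := pfg (i + j)%N; rewrite coefM.
have lti : (i < (i + j).+1)%N by rewrite ltnS leq_addr.
rewrite (bigD1 (Ordinal lti)) //= addKn => pS.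
suff /pP[] : divides p (f`_i * g`_j) by [].
rewrite -[_ * _](addrK (\sum_(k < (i + j).+1 | k != Ordinal lti) f`_k * g`_(i + j - k))).
apply: dividesB => //; apply: divides_sum => k; rewrite -val_eqE /= neq_ltn.
case/orP=> [ki|ik]; first by apply: divides_mulr; exact: fl.
apply: divides_mull; apply: gl; rewrite ltn_subLR ?ltn_add2r //.
by rewrite -ltnS.
Qed.

Definition primitive_polynomial R (f : {poly R}) :=
  forall p : R, prime_element p -> ~ divides p%:P f.

Lemma primitive_part R (f : {poly R}) : factorial_ring R -> f != 0 ->
  exists (s : seq R) f0, [/\ forall p, p \in s -> prime_element p,
    primitive_polynomial f0 & f = (\prod_(p <- s) p)%:P * f0].
Proof.
move=> factR f0; have lf0 : lead_coef f != 0 by rewrite lead_coef_eq0.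
have [u [s [uU sP lE]]] := factR _ lf0.
elim: (size s).+1 {-2}s (ltnSn (size s)) u uU sP f f0 lf0 lE => // N IH {}s.
rewrite ltnS => sN u uU sP f f0 lf0 lE.
have [prim|/existsNP[p /not_implyP[pp /contrapT[g fE]]]] :=
  pselect (primitive_polynomial f).
  by exists [::], f; rewrite big_nil mul1r.
have lgE : p * lead_coef g = u * \prod_(q <- s) q.
  by rewrite -lE fE lead_coefM lead_coefC.
have g0 : g != 0 by apply: contra_neq f0; rewrite fE => ->; rewrite mulr0.
have [u' [s' [u'U s'P bE s's]]] := divide_factorization pp uU sP lgE.
have [||t [h [tP hprim gE]]] := IH s' _ u' u'U s'P g g0 _ bE.
- exact: leq_trans sN.
- by rewrite lead_coef_eq0.
exists (p :: t), h; split=> //.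
  by move=> q; rewrite inE => /orP[/eqP-> //|]; exact: tP.
by rewrite big_cons polyCM -mulrA -gE.
Qed.

(** By the primality of constants, each prime factor of c divides g or h, so
    the factors of c can be cancelled one by one. This is what turns the
    pseudo-divisions of polynomials over R into divisions. *)
Lemma clear_denominator R (c : R) (f g h : {poly R}) :
    factorial_ring R -> c != 0 -> c%:P * f = g * h ->
  exists g' h' (d e : R), [/\ d != 0, e != 0, g = d%:P * g', h = e%:P * h' & f = g' * h'].
Proof.
move=> factR c0; have [u [s [uU sP ->]]] := factR _ c0.
elim: s g h sP => [|p s IH] g h sP.
  rewrite big_nil mulr1 => E; exists g, (u^-1%:P * h), 1, u.
  have u0 : u != 0 by apply: contraTneq uU => ->; rewrite unitr0.
  split; rewrite ?oner_neq0 ?mul1r //; first by rewrite mulrA -polyCM divrr // mul1r.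
  by rewrite mulrCA -E mulrA -polyCM mulVr // mul1r.
have pp : prime_element p by apply: sP; rewrite mem_head.
have p0 : p != 0 by case: pp.
have {}sP q : q \in s -> prime_element q by move=> qs; apply: sP; rewrite inE qs orbT.
rewrite big_cons mulrCA polyCM -mulrA => E.
have [_ _ /(_ g h)[]] := prime_polyC pp; first by rewrite -E; eexists.
- case=> g1 gE; have /(IH _ _ sP)[g' [h' [d [e [d0 e0 g1E hE fE]]]]] :
      (u * \prod_(q <- s) q)%:P * f = g1 * h.
    apply: (@mulfI _ p%:P); first by rewrite polyC_eq0.
    by rewrite E gE mulrA.
  exists g', h', (p * d), e; split=> //; first by rewrite mulf_neq0.
  by rewrite gE g1E mulrA polyCM.
- case=> h1 hE; have /(IH _ _ sP)[g' [h' [d [e [d0 e0 gE h1E fE]]]]] :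
      (u * \prod_(q <- s) q)%:P * f = g * h1.
    apply: (@mulfI _ p%:P); first by rewrite polyC_eq0.
    by rewrite E hE mulrCA.
  exists g', h', d, (p * e); split=> //; first by rewrite mulf_neq0.
  by rewrite hE h1E mulrA polyCM.
Qed.

Lemma primitive_divides R (c : R) (f a q : {poly R}) :
    factorial_ring R -> primitive_polynomial f -> c != 0 -> c%:P * a = f * q ->
  divides f a.
Proof.
move=> factR fprim c0 /(clear_denominator factR c0).
move=> [f' [q' [d [e [d0 _ fE _ aE]]]]].
have [u [[|p s] [uU sP dE]]] := factR _ d0.
  exists (u^-1%:P * q'); rewrite aE fE dE big_nil mulr1 mulrACA -polyCM.
  by rewrite divrr // mul1r.
case: (fprim p); first by apply: sP; rewrite mem_head.
by rewrite fE dE big_cons mulrCA polyCM -mulrA; eexists.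
Qed.

(** Gauss: Euclid's lemma holds for polynomials up to a constant factor, and a
    primitive polynomial absorbs this factor. *)
Lemma primitive_irreducible_prime R (f : {poly R}) :
    factorial_ring R -> primitive_polynomial f -> irreducible_poly f ->
  prime_element f.
Proof.
move=> factR fprim [sf firr].
have f0 : f != 0 by rewrite -size_poly_gt0 (leq_trans _ sf).
split=> //; first by rewrite poly_unitE; case: eqP sf => // ->.
have main a : f %| a -> divides f a.
  move=> /Pdiv.Idomain.dvdpP[[c q] /= c0 E].
  by apply: (primitive_divides (q := q) factR fprim c0); rewrite mul_polyC E mulrC.
move=> a b [g abE]; have fab : f %| a * b by rewrite abE dvdp_mulIl.
have [cop|ncop] := boolP (coprimep f a).
  by right; apply: main; rewrite -(Gauss_dvdpr _ cop).
left; apply: main; rewrite -(eqp_dvdl _ (firr _ ncop (dvdp_gcdl _ _))).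
exact: dvdp_gcdr.
Qed.

Lemma prime_factorizationM R (a b : R) :
  prime_factorization a -> prime_factorization b -> prime_factorization (a * b).
Proof.
move=> [u [s [uU sP ->]]] [v [t [vU tP ->]]]; exists (u * v), (s ++ t).
split; first by rewrite unitrM uU.
  by move=> p; rewrite mem_cat => /orP[/sP|/tP].
by rewrite big_cat /= mulrACA.
Qed.

(** Split off the primes of R; then a primitive polynomial either is prime or has
    a pseudo-divisor of smaller degree, which clearing denominators turns into a
    genuine factorization. *)
Lemma factorial_poly R : factorial_ring R -> factorial_ring {poly R}.
Proof.
move=> factR f; elim: (size f).+1 {-2}f (ltnSn (size f)) => // N IH {}f.
rewrite ltnS => fN f0; have [s [g [sP gprim fE]]] := primitive_part factR f0.
have g0 : g != 0 by apply: contra_neq f0; rewrite fE => ->; rewrite mulr0.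
have gf : (size g <= size f)%N.
  rewrite fE mul_polyC size_scale //; apply: contra_neq f0 => s0.
  by rewrite fE s0 mul0r.
rewrite fE; apply: prime_factorizationM.
  exists 1, (map polyC s); split; rewrite ?unitr1 //.
    by move=> _ /mapP[p /sP pp ->]; exact: prime_polyC.
  by rewrite mul1r big_map rmorph_prod.
have [g1|sg1] := leqP (size g) 1.
  exists g, [::]; split=> //; last by rewrite big_nil mulr1.
  rewrite (size1_polyC g1) poly_unitE coefC eqxx size_polyC.
  have gC0 : g`_0 != 0.
    by apply: contra_neq g0 => g00; rewrite (size1_polyC g1) g00.
  rewrite gC0 /=; have [u [[|p t] [uU tP gE]]] := factR _ gC0.
    by rewrite gE big_nil mulr1.
  case: (gprim p); first by apply: tP; rewrite mem_head.
  rewrite (size1_polyC g1) gE big_cons mulrCA polyCM; by eexists.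
have [irr|] := pselect (irreducible_poly g).
  exists 1, [:: g]; rewrite unitr1 big_seq1 mul1r; split=> // p.
  by rewrite inE => /eqP->; exact: primitive_irreducible_prime.
move=> /not_andP[//|/existsNP[q /not_implyP[q1 /not_implyP[qg nqg]]]].
have /Pdiv.Idomain.dvdpP[[c r] /= c0 E] := qg.
have [|r' [q' [d [e [d0 e0 rE qE gE]]]]] :=
    clear_denominator (c := c) (f := g) (g := r) (h := q) factR c0.
  by rewrite mul_polyC.
have sq : size q' = size q by rewrite qE mul_polyC size_scale.
move: g0; rewrite gE mulf_eq0 negb_or => /andP[r'0 q'0].
have q0 : q != 0 by rewrite qE mulf_neq0 ?polyC_eq0.
have sqg : (size q < size g)%N.
  rewrite ltn_neqAle; apply/andP; split; last first.
    by apply: dvdp_leq => //; rewrite gE mulf_neq0.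
  by apply/negP => /eqP/eqP; rewrite (dvdp_size_eqp qg).
have sq2 : (1 < size q)%N by rewrite ltn_neqAle eq_sym q1 size_poly_gt0.
have gE' : (size g).+1 = (size r' + size q')%N.
  rewrite gE size_mul // prednK // addn_gt0 size_poly_gt0 r'0 //.
apply: prime_factorizationM; apply: IH => //.
- by apply: (@leq_trans (size g)); rewrite ?(leq_trans gf) // -ltnS gE' -addn2 leq_add2l sq.
- by rewrite sq; apply: (leq_trans sqg); exact: leq_trans fN.
Qed.

Lemma factorial_field (K : fieldType) : factorial_ring K.
Proof.
by move=> a a0; exists a, [::]; rewrite unitfE a0 big_nil mulr1; split.
Qed.

Lemma factorial_iso (R R' : idomainType) (f : {rmorphism R -> R'})
    (g : {rmorphism R' -> R}) :
  cancel f g -> cancel g f -> factorial_ring R -> factorial_ring R'.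
Proof.
move=> fK gK factR a a0; have ga0 : g a != 0.
  by apply: contra_neq a0 => ga0; rewrite -(gK a) ga0 rmorph0.
have [u [s [uU sP gaE]]] := factR _ ga0; exists (f u), (map f s); split.
- exact: rmorph_unit.
- move=> _ /mapP[p /sP[p0 pU pP] ->]; split.
  + by apply: contra_neq p0 => fp0; rewrite -(fK p) fp0 rmorph0.
  + by apply: contra pU => /(rmorph_unit g); rewrite fK.
  + move=> b c [d bcE]; have /pP : divides p (g b * g c).
      by exists (g d); rewrite -rmorphM bcE rmorphM fK.
    by case=> -[e eE]; [left|right]; exists (f e); rewrite -rmorphM -eE gK.
- by rewrite -(gK a) gaE rmorphM rmorph_prod big_map.
Qed.

End Factoriality.

(** * Factoriality of the ring of multivariate polynomials *)

Section MPolyFactorial.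
Variables (K : fieldType).

Section Iterated.
Variable n : nat.

Lemma comm_last_var : commr_rmorph (@mwiden n K) 'X_ord_max.
Proof. by move=> p; exact: mulrC. Qed.

Definition mpoly_of_poly : {poly {mpoly K[n]}} -> {mpoly K[n.+1]} :=
  horner_morph comm_last_var.
HB.instance Definition _ := GRing.RMorphism.on mpoly_of_poly.

Lemma muni_monomial (m : 'X_{1..n.+1}) : muni ('X_[m] : {mpoly K[n.+1]}) =
  ('X_[[multinom m (widen_ord (leqnSn n) i) | i < n]])%:P * 'X^(m ord_max).
Proof.
by rewrite muniE msuppX big_seq1 mcoeffX eqxx scale1r mul_polyC.
Qed.

Lemma muni_widen (p : {mpoly K[n]}) : muni (mwiden p) = p%:P.
Proof.
elim/mpolyind: p => [|c m p _ _ IH]; first by rewrite !rmorph0.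
rewrite !(rmorphD, rmorphM) /= IH; congr (_ + _).
rewrite mwidenZ mwidenX muniZ muni_monomial mnmwiden_ordmax expr0 mulr1 -mul_mpolyC.
rewrite polyCM mul_polyC; congr (_ *: 'X_[_]%:P).
by apply/mnmP => i; rewrite mnmE mnmwiden_widen.
Qed.

Lemma muni_last : muni ('X_ord_max : {mpoly K[n.+1]}) = 'X.
Proof.
rewrite muni_monomial mnm1E eqxx expr1 -[RHS]mul1r -polyC1 -mpolyX0.
congr ('X_[_]%:P * _).
by apply/mnmP => i; rewrite mnmE mnm0E mnm1E -val_eqE /= gtn_eqF.
Qed.

Lemma mpoly_of_polyC (p : {mpoly K[n]}) : mpoly_of_poly p%:P = mwiden p.
Proof. exact: horner_morphC. Qed.

Lemma mpoly_of_poly_var : mpoly_of_poly 'X = 'X_ord_max.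
Proof. exact: horner_morphX. Qed.

Lemma mpoly_of_polyD : {morph mpoly_of_poly : p q / p + q}.
Proof. exact: rmorphD. Qed.

Lemma mpoly_of_polyM : {morph mpoly_of_poly : p q / p * q}.
Proof. exact: rmorphM. Qed.

(** Together with the next cancellation, this identifies polynomials in n + 1
    variables with polynomials in the last variable over the first n. *)
Lemma mpoly_of_polyK : cancel mpoly_of_poly (@muni n K).
Proof.
elim/poly_ind => [|p c IH]; first by rewrite !rmorph0.
rewrite mpoly_of_polyD mpoly_of_polyM mpoly_of_polyC mpoly_of_poly_var muniD muniM IH.
by rewrite muni_last muni_widen.
Qed.

Lemma muniK : cancel (@muni n K) mpoly_of_poly.
Proof.
elim/mpolyind => [|c m p _ _ IH]; first by rewrite muni0 rmorph0.
rewrite muniD mpoly_of_polyD; apply: (congr2 +%R _ IH).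
rewrite muniZ -mul_polyC muni_monomial mpoly_of_polyM mpoly_of_polyC mwidenC mul_mpolyC.
rewrite mpoly_of_polyM rmorphXn /= mpoly_of_polyC mpoly_of_poly_var mwidenX mpolyXn -mpolyXD.
congr (_ *: 'X_[_]); apply/mnmP => i; rewrite mnmDE mulmnE mnm1E.
case: (unliftP ord_max i) => [j|] -> /=; last first.
  by rewrite mnmwiden_ordmax eqxx mul1n.
have -> : lift ord_max j = widen_ord (leqnSn n) j by apply: val_inj; exact: lift_max.
by rewrite mnmwiden_widen mnmE -val_eqE /= gtn_eqF // addn0.
Qed.

End Iterated.

Theorem factorial_mpoly n : factorial_ring {mpoly K[n]}.
Proof.
elim: n => [|n IH].
  apply: (@factorial_iso K {mpoly K[0]} (@mpolyC 0 K) (@mcoeff 0 K 0%MM)).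
  - exact: mpolyCK.
  - exact: mpolyKC.
  - exact: factorial_field.
apply: (@factorial_iso {poly {mpoly K[n]}} {mpoly K[n.+1]} (@mpoly_of_poly n) (@muni n K)).
- exact: mpoly_of_polyK.
- exact: muniK.
- exact: factorial_poly.
Qed.

End MPolyFactorial.

(** * Dimensions of quotients of subspaces *)

Section Dimension.
Variables (K : fieldType) (n : nat).
Implicit Types (A B : set {mpoly K[n]}) (p q g : {mpoly K[n]}).

Definition subspace A : Prop :=
  A 0 /\ forall (c : K) p q, A p -> A q -> A (c *: p + q).

Definition lincomb r (v : 'I_r -> {mpoly K[n]}) (c : 'rV[K]_r) : {mpoly K[n]} :=
  \sum_i c 0 i *: v i.

Definition spans_mod A B (r : nat) : Prop :=
  exists2 v : 'I_r -> {mpoly K[n]}, (forall i, A (v i)) &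
    forall p, A p -> exists c, B (p - lincomb v c).

Definition indep_mod A B (r : nat) : Prop :=
  exists2 v : 'I_r -> {mpoly K[n]}, (forall i, A (v i)) &
    forall c, B (lincomb v c) -> c = 0.

Lemma subspace0 A : subspace A -> A 0. Proof. by case. Qed.

Lemma subspaceZ A (c : K) p : subspace A -> A p -> A (c *: p).
Proof. by case=> A0 h Ap; rewrite -[_ *: _]addr0; exact: h. Qed.

Lemma subspaceD A p q : subspace A -> A p -> A q -> A (p + q).
Proof. by case=> A0 h Ap Aq; rewrite -[p]scale1r; exact: h. Qed.

Lemma subspaceN A p : subspace A -> A p -> A (- p).
Proof. by move=> sA Ap; rewrite -scaleN1r; exact: subspaceZ. Qed.

Lemma subspaceB A p q : subspace A -> A p -> A q -> A (p - q).
Proof. by move=> sA Ap Aq; apply: subspaceD => //; exact: subspaceN. Qed.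

Lemma subspace_sum A (I : Type) (s : seq I) (P : pred I) (F : I -> {mpoly K[n]}) :
  subspace A -> (forall i, P i -> A (F i)) -> A (\sum_(i <- s | P i) F i).
Proof.
by move=> sA AF; apply: big_ind => //; [exact: subspace0|move=> *; exact: subspaceD].
Qed.

Lemma subspace_lincomb A r (v : 'I_r -> {mpoly K[n]}) c :
  subspace A -> (forall i, A (v i)) -> A (lincomb v c).
Proof. by move=> sA Av; apply: subspace_sum => // i _; exact: subspaceZ. Qed.

Lemma subspaceI A B : subspace A -> subspace B -> subspace (A `&` B).
Proof.
by move=> [A0 hA] [B0 hB]; split=> // c p q [? ?] [? ?]; split; [apply: hA|apply: hB].
Qed.

Lemma subspaceT : subspace setT. Proof. by []. Qed.

Lemma subspace_zero : subspace [set 0].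
Proof. by split=> // c p q /= -> ->; rewrite scaler0 addr0. Qed.

Lemma lincombB r (v : 'I_r -> {mpoly K[n]}) c d :
  lincomb v (c - d) = lincomb v c - lincomb v d.
Proof.
by rewrite /lincomb -sumrB; apply: eq_bigr => i _; rewrite !mxE scalerBl.
Qed.

Lemma lincombZ r (v : 'I_r -> {mpoly K[n]}) a c : lincomb v (a *: c) = a *: lincomb v c.
Proof.
by rewrite /lincomb scaler_sumr; apply: eq_bigr => i _; rewrite mxE scalerA.
Qed.

Lemma lincomb0 r (v : 'I_r -> {mpoly K[n]}) : lincomb v 0 = 0.
Proof. by rewrite -(subrr 0) lincombB subrr. Qed.

Definition join_families r s (v : 'I_r -> {mpoly K[n]}) (w : 'I_s -> {mpoly K[n]})
    (i : 'I_(r + s)) : {mpoly K[n]} :=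
  match split i with inl a => v a | inr b => w b end.

Lemma lincomb_join r s (v : 'I_r -> {mpoly K[n]}) (w : 'I_s -> _) c d :
  lincomb (join_families v w) (row_mx c d) = lincomb v c + lincomb w d.
Proof.
rewrite /lincomb big_split_ord /=; congr (_ + _); apply: eq_bigr => i _.
  by rewrite row_mxEl /join_families -[lshift s i]/(unsplit (inl i)) unsplitK.
by rewrite row_mxEr /join_families -[rshift r i]/(unsplit (inr i)) unsplitK.
Qed.

Lemma join_families_in A r s (v : 'I_r -> {mpoly K[n]}) (w : 'I_s -> _) :
  (forall i, A (v i)) -> (forall i, A (w i)) -> forall i, A (join_families v w i).
Proof. by move=> Av Aw i; rewrite /join_families; case: split. Qed.

Lemma mul_lincomb g r (v : 'I_r -> {mpoly K[n]}) c :
  g * lincomb v c = lincomb (fun i => g * v i) c.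
Proof. by rewrite /lincomb mulr_sumr; apply: eq_bigr => i _; rewrite scalerAr. Qed.

Lemma quotient_dim_spans A B r : quotient_dim A B r -> spans_mod A B r.
Proof.
case=> v Av h; exists v => // p /h[c [Bc _]]; by exists c.
Qed.

Lemma quotient_dim_indep A B r : subspace A -> subspace B ->
  quotient_dim A B r -> indep_mod A B r.
Proof.
move=> sA sB [v Av h]; exists v => // c Bc.
have [d [_ uniq]] := h _ (subspace0 sA).
rewrite -(uniq c); last by rewrite sub0r; exact: (subspaceN sB Bc).
apply: uniq; rewrite -/(lincomb v 0) lincomb0 subr0; exact: (subspace0 sB).
Qed.

(** The exchange argument: expand the independent family in the spanning one; a
    matrix with more rows than columns has a row in its kernel. *)
Lemma indep_le_spans A B r s : subspace B ->
  indep_mod A B r -> spans_mod A B s -> (r <= s)%N.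
Proof.
move=> sB [u Au uind] [v _ vspan].
have /choice[c cE] : forall i, exists c, B (u i - lincomb v c) by move=> i; exact: vspan.
pose M := \matrix_(i < r, j < s) c i 0 j.
rewrite leqNgt; apply/negP => sr.
have : kermx M != 0.
  rewrite -mxrank_eq0 mxrank_ker subn_eq0 -ltnNge.
  exact: leq_ltn_trans (rank_leq_col M) sr.
case/rowV0Pn => z /sub_kermxP zM /negP; apply; apply/eqP; apply: uind.
have -> : lincomb u z = \sum_i z 0 i *: (u i - lincomb v (c i)).
  rewrite /lincomb; under [RHS]eq_bigr do rewrite scalerBr scaler_sumr.
  rewrite sumrB exchange_big /= [X in _ - X]big1 ?subr0 // => j _.
  under eq_bigr do rewrite scalerA.
  rewrite -scaler_suml; have /rowP/(_ j) := zM; rewrite !mxE => E.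
  suff -> : \sum_i z 0 i * c i 0 j = 0 by rewrite scale0r.
  by rewrite -[RHS]E; apply: eq_bigr => i _; rewrite mxE.
by apply: subspace_sum => // i _; exact: subspaceZ.
Qed.

(** dim A/B' <= dim A/B + dim A2/B2 when A `&` B lies in g A2 + B' and g B2
    lies in B'. All the dimension estimates below come from this lemma and the
    next one. *)
Lemma spans_mod_extend A B A2 B2 B' g r s :
    subspace A -> subspace A2 -> subspace B' ->
    (forall q, A2 q -> A (g * q)) ->
    (forall p, A p -> B p -> exists2 q, A2 q & B' (p - g * q)) ->
    (forall q, A2 q -> B2 q -> B' (g * q)) ->
  spans_mod A B r -> spans_mod A2 B2 s -> spans_mod A B' (r + s).
Proof.
move=> sA sA2 sB' gA ABg gB2 [v Av vspan] [w Aw wspan].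
exists (join_families v (fun i => g * w i)).
  by apply: join_families_in => // i; apply: gA.
move=> p Ap; have [c Bc] := vspan _ Ap.
have [|q A2q qE] := ABg _ _ Bc.
  by apply: subspaceB => //; exact: subspace_lincomb.
have [d Bd] := wspan _ A2q.
exists (row_mx c d); rewrite lincomb_join -mul_lincomb.
have -> : p - (lincomb v c + g * lincomb w d) =
    (p - lincomb v c - g * q) + g * (q - lincomb w d) by rewrite mulrBr opprD !addrA subrK.
apply: subspaceD => //; apply: gB2 => //.
by apply: subspaceB => //; exact: subspace_lincomb.
Qed.

(** dim A/B + dim A2/B2 <= dim A/B' when multiplication by g embeds A2/B2 into
    (A `&` B)/B'. *)
Lemma indep_mod_extend A B A2 B2 B' g r s :
    subspace A2 -> subspace B -> B' `<=` B ->
    (forall q, A2 q -> A (g * q) /\ B (g * q)) ->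
    (forall q, A2 q -> B' (g * q) -> B2 q) ->
  indep_mod A B r -> indep_mod A2 B2 s -> indep_mod A B' (r + s).
Proof.
move=> sA2 sB B'B gAB gB' [v Av vind] [w Aw wind].
exists (join_families v (fun i => g * w i)).
  by apply: join_families_in => // i; case: (gAB _ (Aw i)).
move=> c; rewrite -[c]hsubmxK lincomb_join -mul_lincomb => cB'.
have A2d : A2 (lincomb w (rsubmx c)) by exact: subspace_lincomb.
have [_ Bd] := gAB _ A2d.
have c0 : lsubmx c = 0.
  apply: vind; rewrite -[lincomb _ _](addrK (g * lincomb w (rsubmx c))).
  by apply: subspaceB => //; exact: B'B.
move: cB'; rewrite c0 lincomb0 add0r => /(gB' _ A2d)/wind ->.
by rewrite row_mx0.
Qed.

(** A maximal independent family exists because the length is bounded by N. *)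
Lemma spans_mod_basis A B A2 N : subspace B -> A2 `<=` A ->
  spans_mod A B N -> exists2 s, indep_mod A2 B s & spans_mod A2 B s.
Proof.
move=> sB A2A spanN.
have ex0 : exists r, `[< indep_mod A2 B r >].
  exists 0%N; apply/asboolP; exists (fun=> 0); first by case.
  by move=> c _; apply/rowP; case.
have ub r : `[< indep_mod A2 B r >] -> (r <= N)%N.
  move=> /asboolP[v Av vi]; apply: indep_le_spans spanN => //.
  by exists v => // i; exact: A2A.
case: (ex_maxnP ex0 ub) => s /asboolP[v Av vi] smax.
exists s; first by exists v.
exists v => // p A2p; apply: contrapT => nspan.
suff /smax : `[< indep_mod A2 B (s + 1) >] by rewrite addn1 ltnn.
apply/asboolP; exists (join_families v (fun i : 'I_1 => p)).
  exact: join_families_in.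
move=> c; rewrite -[c]hsubmxK lincomb_join {2}/lincomb big_ord1 => Bc.
have d0 : rsubmx c 0 0 = 0.
  apply: contrapT => /eqP d0; apply: nspan.
  exists (- (rsubmx c 0 0)^-1 *: lsubmx c).
  rewrite lincombZ -[p](scalerK d0) scaleNr opprK -scalerDr addrC.
  exact: subspaceZ.
move: Bc; rewrite d0 scale0r addr0 => /vi ->.
have -> : rsubmx c = 0 by apply/rowP => j; rewrite ord1 d0 mxE.
by rewrite row_mx0.
Qed.

Lemma quotient_dim_uniq A B r s : subspace A -> subspace B ->
  quotient_dim A B r -> quotient_dim A B s -> r = s.
Proof.
move=> sA sB dr ds; apply/eqP; rewrite eqn_leq; apply/andP; split.
  by apply: indep_le_spans (quotient_dim_spans ds) => //; exact: quotient_dim_indep.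
by apply: indep_le_spans (quotient_dim_spans dr) => //; exact: quotient_dim_indep.
Qed.

Lemma spans_mod_onto A B C r : subspace B -> A `<=` C ->
  (forall p, C p -> exists2 q, A q & B (p - q)) ->
  spans_mod C B r -> spans_mod A B r.
Proof.
move=> sB AC onto [v Cv vspan].
have /choice[w wE] : forall i, exists q, A q /\ B (v i - q).
  by move=> i; have [q] := onto _ (Cv i); exists q.
exists w => [i|p Ap]; first by have [] := wE i.
have [c Bc] := vspan _ (AC _ Ap); exists c.
have -> : p - lincomb w c = p - lincomb v c + lincomb (fun i => v i - w i) c.
  rewrite /lincomb; under [X in _ = _ + X]eq_bigr do rewrite scalerBr.
  by rewrite sumrB addrA subrK.
by apply: subspaceD => //; apply: subspace_lincomb => // i; have [] := wE i.
Qed.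

Lemma indep_mod_onto A B C r : subspace B -> 
  (forall p, C p -> exists2 q, A q & B (p - q)) ->
  indep_mod C B r -> indep_mod A B r.
Proof.
move=> sB onto [v Cv vi].
have /choice[w wE] : forall i, exists q, A q /\ B (v i - q).
  by move=> i; have [q] := onto _ (Cv i); exists q.
exists w => [i|c Bc]; first by have [] := wE i.
apply: vi; have -> : lincomb v c = lincomb w c + lincomb (fun i => v i - w i) c.
  rewrite /lincomb; under [X in _ = _ + X]eq_bigr do rewrite scalerBr.
  by rewrite sumrB addrC subrK.
by apply: subspaceD => //; apply: subspace_lincomb => // i; have [] := wE i.
Qed.

Lemma spans_mod_sub A B B' r : B `<=` B' -> spans_mod A B r -> spans_mod A B' r.
Proof. by move=> BB [v Av h]; exists v => // p /h[c /BB]; exists c. Qed.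

End Dimension.

(** * Dimension of the spaces of forms *)

Section Forms.
Variables (K : fieldType) (n : nat).

Definition forms (t : nat) : set {mpoly K[n]} := [set f | f \is t.-homog].

Lemma subspace_forms t : subspace (forms t).
Proof.
split=> [|c p q]; first exact: dhomog0.
by move=> hp hq; apply: rpredD => //; exact: rpredZ.
Qed.

End Forms.

Section FormsDim.
Variables (K : fieldType) (n : nat).

(** The coordinates of the vector space structure on homogeneous polynomials,
    restated inside the polynomial ring. *)
Lemma forms_basis t : exists2 v : 'I_('C(t + n, t)) -> {mpoly K[n.+1]},
  (forall i, forms t (v i)) & (forall p, forms t p -> exists c, p = lincomb v c)
   /\ (forall c, lincomb v c = 0 -> c = 0).
Proof.
have [f lf [g gK fK]] := dhomog_vecaxiom n K t.
have fD u v : f (u + v) = f u + f v by have := lf 1 u v; rewrite !scale1r.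
have f0 : f 0 = 0 by apply: (addrI (f 0)); rewrite -fD !addr0.
have fZ a u : f (a *: u) = a *: f u by have := lf a u 0; rewrite f0 !addr0.
have fs (c : 'rV[K]_('C(t + n, t))) : \sum_i c 0 i *: (g (delta_mx 0 i)) = g c.
  apply: (can_inj gK); rewrite (big_morph f fD f0) fK [RHS]row_sum_delta.
  by apply: eq_bigr => i _; rewrite fZ fK.
have val_sum c : lincomb (fun i => val (g (delta_mx 0 i))) c = val (g c).
  rewrite -fs /lincomb.
  by rewrite [RHS](raddf_sum (@mpoly_of_dhomog n.+1 K t)).
exists (fun i => val (g (delta_mx 0 i))); first by move=> i; exact: dhomog_is_dhomog.
split=> [p hp|c].
  by exists (f (DHomog hp)); rewrite val_sum gK.
rewrite val_sum => g0; have : g c = 0 by exact: val_inj.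
by move/(congr1 f); rewrite fK f0.
Qed.

Lemma forms_spans t : spans_mod (forms t : set {mpoly K[n.+1]}) [set 0] 'C(t + n, t).
Proof.
have [v vh [vs _]] := forms_basis t; exists v => // p /vs[c ->].
by exists c; rewrite /= subrr.
Qed.

Lemma forms_indep t : indep_mod (forms t : set {mpoly K[n.+1]}) [set 0] 'C(t + n, t).
Proof. by have [v vh [_ vi]] := forms_basis t; exists v. Qed.

End FormsDim.

(** * Evaluation over an infinite field *)

(** Nonzero arguments suffice, as the scalings of projective coordinates provide
    only these. *)
Definition infinite_field (K : fieldType) : Prop :=
  forall p : {poly K}, (forall a, a != 0 -> p.[a] = 0) -> p = 0.

Lemma infinite_numField (K : numFieldType) : infinite_field K.
Proof.
move=> p p0; apply: contrapT => /eqP pn0.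
pose s := [seq k%:R : K | k <- iota 1 (size p)].
have : (size s < size p)%N.
  apply: max_poly_roots => //.
    apply/allP => _ /mapP[k + ->]; rewrite mem_iota => /andP[k0 _].
    by apply/rootP/p0; rewrite pnatr_eq0 -lt0n.
  by rewrite map_inj_uniq ?iota_uniq // => a b /eqP; rewrite eqr_nat => /eqP.
by rewrite size_map size_iota ltnn.
Qed.

Section Evaluation.
Variables (K : fieldType) (Kinf : infinite_field K).

Lemma meval_mpoly_of_poly n (p : {poly {mpoly K[n]}}) (v : 'I_n.+1 -> K) :
  (mpoly_of_poly p).@[v] =
  (map_poly (meval (fun j => v (widen_ord (leqnSn n) j))) p).[v ord_max].
Proof.
elim/poly_ind: p => [|p c IH]; first by rewrite !rmorph0 horner0.
rewrite mpoly_of_polyD mpoly_of_polyM mevalD mevalM IH mpoly_of_poly_var mevalXU.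
rewrite rmorphD rmorphM /= map_polyX map_polyC /= hornerD hornerMX hornerC.
congr (_ + _); rewrite mpoly_of_polyC.
elim/mpolyind: c => [|a m q _ _ IHc]; first by rewrite rmorph0 !meval0.
rewrite mwidenD !mevalD IHc mwidenZ !mevalZ mwidenX !mevalX big_ord_recr /=.
rewrite mnmwiden_ordmax expr0 mulr1; congr (_ * _ + _).
by apply: eq_bigr => j _; rewrite mnmwiden_widen.
Qed.

Lemma mpoly_eq0_of_meval n (f : {mpoly K[n]}) : (forall v, f.@[v] = 0) -> f = 0.
Proof.
elim: n f => [|n IH] f f0.
  by move: (f0 (fun=> 0)); rewrite (nvar0_mpolyC f) mevalC => ->; rewrite mpolyC0.
rewrite -(muniK f); suff -> : muni f = 0 by rewrite rmorph0.
apply/polyP => k; rewrite coef0; apply: IH => v.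
rewrite -[LHS](coef_map (meval v)).
suff -> : map_poly (meval v) (muni f) = 0 by rewrite coef0.
apply: Kinf => a _.
pose u (j : 'I_n.+1) := if unlift ord_max j is Some l then v l else a.
have ua : u ord_max = a by rewrite /u unlift_none.
have := f0 u; rewrite -{1}(muniK f) meval_mpoly_of_poly ua.
suff -> : map_poly (meval (fun j => u (widen_ord (leqnSn n) j))) (muni f) =
  map_poly (meval v) (muni f) by [].
apply: eq_map_poly => q; apply: meval_eq => j.
have -> : widen_ord (leqnSn n) j = lift ord_max j by apply: val_inj; apply/esym; exact: lift_max.
by rewrite /u liftK.
Qed.

Lemma meval_homogZ n (f : {mpoly K[n]}) t a (v : 'rV[K]_n) : f \is t.-homog ->
  f.@[(a *: v) 0] = a ^+ t * f.@[v 0].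
Proof.
move=> /dhomogP hf; rewrite !mevalE mulr_sumr !big_seq; apply: eq_bigr => m /hf mt.
rewrite mulrCA; congr (_ * _).
under eq_bigr do rewrite mxE exprMn.
rewrite big_split /= prodrXr; congr (_ ^+ _ * _).
by rewrite -mdegE.
Qed.

Lemma homog_parts n (f : {mpoly K[n]}) :
  f = \sum_(t < msize f) pihomog mdeg t f.
Proof. exact: pihomog_partitionE. Qed.

Lemma meval_scale n (f : {mpoly K[n]}) a (v : 'rV[K]_n) :
  f.@[(a *: v) 0] = (\poly_(t < msize f) (pihomog mdeg t f).@[v 0]).[a].
Proof.
rewrite {1}(homog_parts f) horner_poly raddf_sum /=; apply: eq_bigr => t _.
by rewrite (meval_homogZ _ _ (pihomogP mdeg t f)) mulrC.
Qed.

End Evaluation.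

(** * Powers of ideals *)

Section Ideals.
Variables (K : fieldType) (n : nat).
Implicit Types (I J M : set {mpoly K[n]}) (f g : {mpoly K[n]}).

Definition ideal I : Prop :=
  [/\ I 0, forall f g, I f -> I g -> I (f + g) & forall f g, I g -> I (f * g)].

Lemma ideal_subspace I : ideal I -> subspace I.
Proof.
case=> I0 ID IM; split=> // c p q Ip Iq; apply: ID => //.
by rewrite -mul_mpolyC; exact: IM.
Qed.

Lemma ideal_vanishing (W : set 'rV[K]_n) : ideal (vanishing_ideal W).
Proof.
split=> [v _|f g If Ig v Wv|f g Ig v Wv]; first by rewrite meval0.
  by rewrite mevalD If // Ig // addr0.
by rewrite mevalM Ig // mulr0.
Qed.

Lemma subspace_vanishing (W : set 'rV[K]_n) : subspace (vanishing_ideal W).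
Proof. exact/ideal_subspace/ideal_vanishing. Qed.

Lemma ideal_add_ideal I J : ideal I -> ideal J -> ideal (ideal_add I J).
Proof.
move=> [I0 ID IM] [J0 JD JM]; split.
- by exists 0, 0; rewrite addr0; split.
- move=> _ _ [a [b [Ia Jb ->]]] [c [d [Ic Jd ->]]]; exists (a + c), (b + d).
  by rewrite addrACA; split; [exact: ID|exact: JD|].
- move=> f _ [a [b [Ia Jb ->]]]; exists (f * a), (f * b).
  by rewrite mulrDr; split; [exact: IM|exact: JM|].
Qed.

Lemma ideal_mul_ideal I J : ideal J -> ideal (ideal_mul I J).
Proof.
move=> [J0 JD JM]; split.
- by exists [::]; rewrite ?big_nil.
- move=> _ _ [s sIJ ->] [t tIJ ->]; exists (s ++ t); last by rewrite big_cat.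
  by move=> u; rewrite mem_cat => /orP[/sIJ|/tIJ].
- move=> f _ [s sIJ ->]; exists [seq (u.1, f * u.2) | u <- s].
    move=> _ /mapP[u us ->] /=; have [? ?] := sIJ _ us.
    by split=> //; exact: JM.
  by rewrite mulr_sumr big_map; apply: eq_bigr => u _ /=; rewrite mulrCA.
Qed.

Lemma ideal_exp_ideal M k : ideal (ideal_exp M k).
Proof. by elim: k => [|k IH]; [split|exact: ideal_mul_ideal]. Qed.

Lemma ideal_mul_mem I J f g : I f -> J g -> ideal_mul I J (f * g).
Proof.
move=> If Jg; exists [:: (f, g)]; last by rewrite big_seq1.
by move=> u; rewrite inE => /eqP->.
Qed.

Lemma ideal_mul_ind I J L : ideal L ->
  (forall f g, I f -> J g -> L (f * g)) -> ideal_mul I J `<=` L.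
Proof.
move=> [L0 LD LM] h _ [s sIJ ->]; rewrite big_seq.
by apply: big_ind => // u /sIJ[]; exact: h.
Qed.

Lemma ideal_exp_mul M a b f g :
  ideal_exp M a f -> ideal_exp M b g -> ideal_exp M (a + b) (f * g).
Proof.
elim: a f => [|a IH] f Mf Mg.
  by have [_ _ h] := ideal_exp_ideal M b; exact: h.
case: Mf => s sM ->; rewrite mulr_suml big_seq.
have [z0 zD _] := ideal_exp_ideal M (a.+1 + b).
apply: big_ind => // u /sM[Mu1 Mu2]; rewrite -mulrA.
by apply: ideal_mul_mem => //; exact: IH.
Qed.

Lemma ideal_exp_le M a b : (a <= b)%N -> ideal_exp M b `<=` ideal_exp M a.
Proof.
move=> /subnK <-; elim: (b - a)%N => [//|c IH].
apply: ideal_mul_ind; first exact: ideal_exp_ideal.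
by move=> f g _ /IH; case: (ideal_exp_ideal M a) => _ _; exact.
Qed.

Lemma ideal_exp1 M f : M f -> ideal_exp M 1 f.
Proof. by move=> Mf; rewrite -[f]mulr1; exact: ideal_mul_mem. Qed.

Lemma ideal_exp_pow M f k : M f -> ideal_exp M k (f ^+ k).
Proof.
move=> Mf; elim: k => [//|k IH]; rewrite exprS -add1n.
by apply: ideal_exp_mul => //; exact: ideal_exp1.
Qed.

End Ideals.

(** * Homogeneous prime ideals *)

Section HomogeneousIdeals.
Variables (K : fieldType) (n : nat) (Kinf : infinite_field K).
Implicit Types (V : set 'rV[K]_n.+1) (f g : {mpoly K[n.+1]}) (v x : 'rV[K]_n.+1).

Lemma zero_locus_scale (T : set {mpoly K[n.+1]}) a v :
    (forall f, T f -> exists t : nat, f \is t.-homog) -> a != 0 ->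
  zero_locus T v -> zero_locus T (a *: v).
Proof.
move=> hT a0 [v0 Tv]; split; first by rewrite scaler_eq0 negb_or a0.
by move=> f Tf; have [t ht] := hT _ Tf; rewrite (meval_homogZ _ _ ht) Tv // mulr0.
Qed.

Lemma closed_scale V a v : closed_subset V -> a != 0 -> V v -> V (a *: v).
Proof. by case=> T hT -> a0; exact: zero_locus_scale. Qed.

Lemma closed_neq0 V v : closed_subset V -> V v -> v != 0.
Proof. by case=> T _ -> []. Qed.

Lemma parts_vanish f v : (forall a, a != 0 -> f.@[(a *: v) 0] = 0) ->
  forall t, (pihomog mdeg t f).@[v 0] = 0.
Proof.
move=> fv t; have P0 : \poly_(t < msize f) (pihomog mdeg t f).@[v 0] = 0.
  by apply: Kinf => a a0; rewrite -meval_scale fv.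
have [tf|ft] := ltnP t (msize f); first by have /polyP/(_ t) := P0; rewrite coef_poly tf coef0.
rewrite pihomogE big_seq_cond big_pred0 ?meval0 // => m.
apply/negP => /andP[/msize_mdeg_lt mf /eqP E].
by move: mf; rewrite E ltnNge ft.
Qed.

Lemma vanishing_parts V f t : closed_subset V ->
  vanishing_ideal V f -> vanishing_ideal V (pihomog mdeg t f).
Proof.
move=> cV Vf v Vv; apply: parts_vanish => a a0; apply: Vf; exact: closed_scale.
Qed.

Lemma ideal_of_parts (I : set {mpoly K[n.+1]}) f :
  subspace I -> (forall t, I (pihomog mdeg t f)) -> I f.
Proof. by move=> sI h; rewrite (homog_parts f); exact: subspace_sum. Qed.

Lemma closedE V v : closed_subset V -> v != 0 ->
  (forall f, vanishing_ideal V f -> f.@[v 0] = 0) -> V v.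
Proof.
case=> T hT VE v0 Vv; rewrite VE; split=> // f Tf; apply: Vv => u.
by rewrite VE => -[_]; exact.
Qed.

(** If f g vanishes on V then, along each line through the origin of the cone
    over V, f or g vanishes identically, since a polynomial in one variable with
    infinitely many roots is zero. So V is covered by the loci of the homogeneous
    parts of f and of g, and topological irreducibility applies. *)
Lemma variety_prime V f g : integral_variety V ->
  vanishing_ideal V (f * g) -> vanishing_ideal V f \/ vanishing_ideal V g.
Proof.
move=> [cV _ irr] fg.
pose Z h := zero_locus [set u | exists t, u = pihomog mdeg t (h : {mpoly K[n.+1]})].
have cZ h : closed_subset (Z h).
  by eexists; last reflexivity; move=> _ [t ->]; exists t; exact: pihomogP.
have sub h : V `<=` Z h -> vanishing_ideal V h.
  move=> VZ; apply: ideal_of_parts; first exact: subspace_vanishing.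
  by move=> t v /VZ[_]; apply; exists t.
suff /(irr _ _ (cZ f) (cZ g))[/sub|/sub] : V `<=` Z f `|` Z g by [left|right].
move=> v Vv; have v0 := closed_neq0 cV Vv.
pose P h := \poly_(t < msize h) (pihomog mdeg t (h : {mpoly K[n.+1]})).@[v 0].
have /eqP : P f * P g = 0.
  apply: Kinf => a a0; rewrite hornerM -!meval_scale -mevalM; apply: fg.
  exact: closed_scale.
have PZ h : P h = 0 -> Z h v.
  move=> Ph; split=> // _ [t ->]; apply: parts_vanish => a a0.
  by rewrite meval_scale -/(P h) Ph horner0.
by rewrite mulf_eq0 => /orP[/eqP/PZ|/eqP/PZ]; [left|right].
Qed.

End HomogeneousIdeals.

(** * Expansion of a form at a point *)

Section ConeForms.
Variables (K : fieldType) (n : nat) (x : 'rV[K]_n.+1).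
Implicit Types (f g : {mpoly K[n.+1]}).

(** For a chart i with x 0 i != 0, these are the forms of degree l in the
    coordinates cone_var, that is the equations of cones with vertex x. The
    description by what is used of such forms does not mention the chart, so that
    the same expansion serves the multiplicities of X and of C at x, which may be
    computed in different charts. *)
Definition cone_form (l : nat) f : Prop :=
  [/\ f \is l.-homog,
      forall (s t : K) v, f.@[(s *: x + t *: v) 0] = t ^+ l * f.@[v 0]
    & forall z, ideal_exp (maximal_ideal (z *: x)) l f].

Lemma subspace_cone_form l : subspace (cone_form l).
Proof.
split; first by split=> [|s t v|z];
  rewrite ?rpred0 // ?meval0 ?mulr0 //; case: (ideal_exp_ideal (maximal_ideal (z *: x)) l).
move=> c f g [hf vf mf] [hg vg mg]; split.
- by apply: rpredD => //; exact: rpredZ.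
- by move=> s t v; rewrite !mevalD !mevalZ vf vg mulrDr mulrCA.
- by move=> z; have [_] := ideal_subspace (ideal_exp_ideal (maximal_ideal (z *: x)) l); apply.
Qed.

Lemma cone_formM a b f g : cone_form a f -> cone_form b g -> cone_form (a + b) (f * g).
Proof.
move=> [hf vf mf] [hg vg mg]; split.
- exact: dhomogM.
- by move=> s t v; rewrite !mevalM vf vg exprD mulrACA.
- by move=> z; exact: ideal_exp_mul.
Qed.

Lemma cone_form_const c : cone_form 0 c%:MP.
Proof.
split=> //; first by rewrite -[c%:MP]mulr1 mul_mpolyC; apply: rpredZ; exact: dhomog1.
by move=> s t v; rewrite !mevalC mul1r.
Qed.

Variables (i : 'I_n.+1) (xi : x 0 i != 0).

Definition cone_var (s : 'I_n.+1) : {mpoly K[n.+1]} := 'X_s - (x 0 s / x 0 i) *: 'X_i.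

Lemma cone_form_var s : cone_form 1 (cone_var s).
Proof.
have E c t v : (cone_var s).@[(c *: x + t *: v) 0] = t * (cone_var s).@[v 0].
  by rewrite !mevalB !mevalZ !mevalXU !mxE; field.
split=> //.
- rewrite /cone_var; apply: rpredB; last apply: rpredZ;
  by rewrite dhomogX; apply/eqP; exact: mdeg1.
- by move=> z; apply: ideal_exp1 => _ ->; have := E z 0 0; rewrite scale0r addr0 mul0r.
Qed.

(** The expansion of f at x in the chart where w = 'X_i is invertible: F l is the
    term of order l of the dehomogenized polynomial. *)
Definition expands_at t f (F : nat -> {mpoly K[n.+1]}) : Prop :=
  (forall l, cone_form l (F l)) /\ f = \sum_(l < t.+1) 'X_i ^+ (t - l) * F l.

Lemma expands_at_lin t c f g F G : expands_at t f F -> expands_at t g G ->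
  expands_at t (c *: f + g) (fun l => c *: F l + G l).
Proof.
move=> [cF ->] [cG ->]; split=> [l|]; first by case: (subspace_cone_form l) => _; apply.
rewrite scaler_sumr -big_split; apply: eq_bigr => l _ /=.
by rewrite mulrDr scalerAr.
Qed.

Lemma expands_at_var t s f F : expands_at t f F ->
  expands_at t.+1 ('X_s * f) (fun l =>
    (if l is l'.+1 then cone_var s * F l' else 0) +
    (if (l <= t)%N then (x 0 s / x 0 i) *: F l else 0)).
Proof.
move=> [cF ->]; split=> [l|].
  apply: subspaceD; first exact: subspace_cone_form.
    case: l => [|l]; first exact: (subspace0 (subspace_cone_form 0)).
    by rewrite -add1n; apply: cone_formM => //; exact: cone_form_var.
  case: ifP => _; last exact: (subspace0 (subspace_cone_form l)).
  by apply: subspaceZ => //; exact: subspace_cone_form.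
under [RHS]eq_bigr do rewrite mulrDr.
rewrite big_split /= [X in _ = X + _]big_ord_recl /= mulr0 add0r.
rewrite [X in _ = _ + X]big_ord_recr /= ltnn mulr0 addr0 -big_split /= mulr_sumr.
apply: eq_bigr => l _; have lt : (l <= t)%N := leq_ord l.
have E : 'X_s = cone_var s + (x 0 s / x 0 i) *: 'X_i by rewrite /cone_var subrK.
rewrite /bump /= add1n subSS lt (subSn lt) exprS E.
rewrite mulrDl; apply: congr2; first exact: mulrCA.
by rewrite -scalerAl -scalerAr mulrA.
Qed.

(** Monomials are handled by induction on the degree, substituting
    'X_s = cone_var s + (x_s / x_i) 'X_i for one variable at a time. *)
Lemma expands_at_homog t f : f \is t.-homog -> exists F, expands_at t f F.
Proof.
have mono m : exists F, expands_at (mdeg m) ('X_[m] : {mpoly K[n.+1]}) F.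
  elim: (mdeg m) {-2}m (erefl (mdeg m)) => [|d IH] {}m md.
    exists (fun l => if l == 0%N then 1 else 0); split=> [l|].
      case: eqP => [->|_]; last exact: (subspace0 (subspace_cone_form l)).
      by rewrite -mpolyC1; exact: cone_form_const.
    rewrite md big_ord1 /= mulr1 expr0; move/eqP: md; rewrite mdeg_eq0 => /eqP ->.
    by rewrite mpolyX0.
  have [s ms] : exists s, m s != 0%N.
    apply: contrapT => /forallNP m0; move: md; rewrite mdegE big1 // => s _.
    by apply/eqP; apply: contrapT => /negP; exact: m0.
  have sm : (U_(s) <= m)%MM.
    by apply/mnm_lepP => j; rewrite mnm1E; case: eqP => // <-; rewrite lt0n.
  have md' : mdeg (m - U_(s))%MM = d.
    by have := mdegD (m - U_(s))%MM U_(s)%MM; rewrite submK // mdeg1 md addn1 => -[].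
  have [F FP] := IH _ md'; move: FP; rewrite md' md => FP; eexists.
  by rewrite -(submK sm) addmC mpolyXD; exact: expands_at_var FP.
move=> /dhomogP hf; rewrite (mpolyE f) big_seq.
apply: (big_ind (fun g => exists F, expands_at t g F)).
- exists (fun=> 0); split=> [l|]; first exact: (subspace0 (subspace_cone_form l)).
  by rewrite big1 // => l _; rewrite mulr0.
- move=> g h [F FP] [G GP]; eexists; rewrite -[g]scale1r; exact: expands_at_lin FP GP.
- move=> m /hf mt; have [F] := mono m; rewrite [mdeg m]mt => FP.
  have [G GP] : exists G, expands_at t 0 G.
    exists (fun=> 0); split=> [l|]; first exact: (subspace0 (subspace_cone_form l)).
    by rewrite big1 // => l _; rewrite mulr0.
  by eexists; rewrite -[_ *: _]addr0; exact: expands_at_lin FP GP.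
Qed.

End ConeForms.

(** * Jets at a point and Bezout by counting dimensions *)

Lemma homog_pow_var (K : fieldType) n (i : 'I_n) N t (f : {mpoly K[n]}) : (t <= N)%N ->
  f \is t.-homog -> 'X_i ^+ (N - t) * f \is N.-homog.
Proof.
move=> /subnK {2}<- hf; apply: dhomogM => //.
rewrite -[X in X.-homog]mul1n; apply: dhomogMn.
by rewrite dhomogX; apply/eqP; exact: mdeg1.
Qed.

Section ChartIdeals.
Variables (K : fieldType) (n : nat).
Implicit Types (V : set 'rV[K]_n.+1) (f g : {mpoly K[n.+1]}) (v : 'rV[K]_n.+1).
Variables (x : 'rV[K]_n.+1) (i : 'I_n.+1).
Hypothesis xi : x 0 i != 0.

(** The functions that vanish to order k at x on V, in the chart x_i = 1; the
    quotient by this ideal is the space of k-jets of V at x, whose dimension is the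
    Hilbert-Samuel function. *)
Definition jet_ideal V k : set {mpoly K[n.+1]} :=
  ideal_add (vanishing_ideal (affine_chart V i))
            (ideal_exp (maximal_ideal ((x 0 i)^-1 *: x)) k).

Lemma ideal_jet V k : ideal (jet_ideal V k).
Proof. by apply: ideal_add_ideal; [exact: ideal_vanishing|exact: ideal_exp_ideal]. Qed.

Lemma subspace_jet V k : subspace (jet_ideal V k).
Proof. exact/ideal_subspace/ideal_jet. Qed.

Lemma jet_chart V k f : vanishing_ideal (affine_chart V i) f -> jet_ideal V k f.
Proof.
move=> Vf; exists f, 0; rewrite addr0; split=> //.
by case: (ideal_exp_ideal (maximal_ideal ((x 0 i)^-1 *: x)) k).
Qed.

Lemma jet_exp V k f : ideal_exp (maximal_ideal ((x 0 i)^-1 *: x)) k f -> jet_ideal V k f.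
Proof. by move=> Mf; exists 0, f; rewrite add0r; split=> // v _; rewrite meval0. Qed.

Lemma jet_affine V k f : (forall v, v 0 i = 1 -> f.@[v 0] = 0) -> jet_ideal V k f.
Proof. by move=> f0; apply: jet_chart => v [_]; exact: f0. Qed.

Lemma vanishing_jet V k : vanishing_ideal V `<=` jet_ideal V k.
Proof. by move=> f Vf; apply: jet_chart => v [Vv _]; exact: Vf. Qed.

Lemma jet_mul V a b f g : jet_ideal V a f -> jet_ideal V b g -> jet_ideal V (a + b) (f * g).
Proof.
move=> [f1 [f2 [If Mf ->]]] [g1 [g2 [Ig Mg ->]]].
have [_ _ IM] := ideal_vanishing (affine_chart V i).
rewrite mulrDl; apply: subspaceD; first exact: subspace_jet.
  by apply: jet_chart; rewrite mulrC; exact: IM.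
rewrite mulrDr; apply: subspaceD; first exact: subspace_jet.
  by apply: jet_chart; exact: IM.
by apply: jet_exp; exact: ideal_exp_mul.
Qed.

Lemma jet_le V a b : (a <= b)%N -> jet_ideal V b `<=` jet_ideal V a.
Proof.
move=> ab _ [f1 [f2 [If Mf ->]]]; exists f1, f2; split=> //; exact: ideal_exp_le Mf.
Qed.

Definition homogenize (N : nat) f : {mpoly K[n.+1]} :=
  \sum_(t < N.+1) 'X_i ^+ (N - t) * pihomog mdeg t f.

Lemma homogenize_homog N f : homogenize N f \is N.-homog.
Proof.
apply: rpred_sum => t _; apply: homog_pow_var; first exact: leq_ord.
exact: pihomogP.
Qed.

Lemma meval_homogenize N f v : (msize f <= N.+1)%N -> v 0 i = 1 ->
  (homogenize N f).@[v 0] = f.@[v 0].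
Proof.
move=> fN vi; rewrite [in RHS](pihomog_partitionE fN) !raddf_sum; apply: eq_bigr => t _ /=.
by rewrite mevalM rmorphXn /= mevalXU vi expr1n mul1r.
Qed.

(** Expand a homogenization of f at x: the terms of order at least k lie in the
    k-th power of the maximal ideal, and the others can be brought to degree t
    because w is congruent to 1 on the chart; this needs t >= k - 1. *)
Lemma forms_jet_onto V k t f : (k <= t.+1)%N ->
  exists2 g, forms t g & jet_ideal V k (f - g).
Proof.
move=> kt; pose N := msize f.
have [F [cF FE]] := expands_at_homog xi (homogenize_homog N f).
exists (\sum_(l < N.+1 | (l < k)%N) 'X_i ^+ (t - l) * F l).
  apply: rpred_sum => l lk; have lt : (l <= t)%N by rewrite -ltnS (leq_trans lk).
  by apply: homog_pow_var => //; case: (cF l).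
rewrite -[f](subrK (homogenize N f)) -addrA; apply: subspaceD; first exact: subspace_jet.
  by apply: jet_affine => v vi; rewrite mevalB meval_homogenize ?subrr.
rewrite FE (bigID (fun l : 'I_N.+1 => (l < k)%N)) /= addrAC -sumrB.
apply: subspaceD; first exact: subspace_jet.
  apply: subspace_sum => [|l lk]; first exact: subspace_jet.
  apply: jet_affine => v vi; rewrite mevalB !mevalM !rmorphXn /= mevalXU vi.
  by rewrite !expr1n subrr.
apply: subspace_sum => [|l]; first exact: subspace_jet.
rewrite -leqNgt => kl; case: (ideal_jet V k) => _ _; apply.
apply: jet_exp; apply: (ideal_exp_le kl); by case: (cF l).
Qed.

(** The factor 'X_i takes care of the points of V outside the chart. *)
Lemma chart_vanishing V f t : closed_subset V -> f \is t.-homog ->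
  vanishing_ideal (affine_chart V i) f -> vanishing_ideal V ('X_i * f).
Proof.
move=> cV hf Wf v Vv; rewrite mevalM mevalXU.
have [->|vi] := eqVneq (v 0 i) 0; first by rewrite mul0r.
have -> : f.@[v 0] = v 0 i ^+ t * f.@[((v 0 i)^-1 *: v) 0].
  by rewrite -(meval_homogZ _ _ hf) scalerKV.
rewrite Wf ?mulr0 //.
by split; [apply: closed_scale => //; rewrite invr_eq0|rewrite mxE mulVf].
Qed.

(** Bezout for the hypersurface G and V, counted at x. Let L(t, k) be the part
    of S_t / I(V) that vanishes to order k at x. The dimension of L(t, k) is at
    least s - r, that of L(t + j, k + j + 1) is s' - r', and multiplication by G
    embeds the former space into the latter. *)
Lemma bezout_count V j k t G r r' s s' :
    G \is j.-homog -> jet_ideal V j.+1 G ->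
    (forall q, vanishing_ideal V (G * q) -> vanishing_ideal V q) ->
    (k <= t)%N ->
    hilbert_samuel V x i k r -> hilbert_samuel V x i (k + j.+1) r' ->
    hilbert_function V t s -> hilbert_function V (t + j) s' ->
  (r' + s <= s' + r)%N.
Proof.
move=> hG JG Greg kt hr hr' hs hs'.
have sI := subspace_vanishing V.
have sF a : subspace (forms a : set {mpoly K[n.+1]}) by exact: subspace_forms.
have [|u Lind Lspan] :=
    spans_mod_basis (A2 := forms t `&` jet_ideal V k) sI _ (quotient_dim_spans hs).
  by move=> f [].
have le1 : (s <= r + u)%N.
  apply: (indep_le_spans sI (quotient_dim_indep (sF _) sI hs)).
  apply: (@spans_mod_extend _ _ (forms t) (jet_ideal V k) (forms t `&` jet_ideal V k)
     (vanishing_ideal V) (vanishing_ideal V) 1) => //.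
  - by apply: subspaceI => //; exact: subspace_jet.
  - by move=> q []; rewrite mul1r.
  - by move=> q Fq Jq; exists q => //; rewrite mul1r subrr; exact: subspace0.
  - by move=> q; rewrite mul1r.
  - apply: (spans_mod_onto (C := setT)) (quotient_dim_spans hr) => //.
      exact: subspace_jet.
    by move=> q _; apply: forms_jet_onto; exact: leqW.
have ir' : indep_mod setT (jet_ideal V (k + j.+1)) r'.
  by apply: quotient_dim_indep => //; exact: subspace_jet.
have le2 : (r' + u <= s')%N.
  apply: (indep_le_spans sI _ (quotient_dim_spans hs')).
  apply: (@indep_mod_extend _ _ (forms (t + j)) (jet_ideal V (k + j.+1)) (forms t `&` jet_ideal V k)
     (vanishing_ideal V) (vanishing_ideal V) G) => //.
  - by apply: subspaceI => //; exact: subspace_jet.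
  - exact: subspace_jet.
  - exact: vanishing_jet.
  - move=> q [Fq Jq]; rewrite mulrC; split; first exact: dhomogM.
    exact: jet_mul.
  - by move=> q _; exact: Greg.
  - apply: (indep_mod_onto (C := setT)) ir'.
      exact: subspace_jet.
    by move=> q _; apply: forms_jet_onto; rewrite addnS ltnS leq_add2r.
by lia.
Qed.

End ChartIdeals.

(** * Growth of polynomials at large integers *)

Section EventualPolynomials.
Implicit Types P Q : {poly rat}.

Lemma rat_large (a : rat) : exists k0, forall k, (k0 <= k)%N -> a <= k%:R.
Proof.
exists (Num.truncn a).+1 => k ak; apply: ltW; apply: (@lt_le_trans _ _ (Num.truncn a).+1%:R).
  by apply: Num.Theory.real_truncnS_gt; exact: num_real.
by rewrite ler_nat.
Qed.

(** The bound e away from 0 makes the induction on the degree work. *)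
Lemma eventually_lead_pos P : 0 < lead_coef P ->
  exists2 e, 0 < e & exists k0, forall k, (k0 <= k)%N -> e <= P.[k%:R].
Proof.
elim/poly_ind: P => [|P c IH]; first by rewrite lead_coef0 ltxx.
have [->|P0] := eqVneq P 0.
  rewrite mul0r add0r lead_coefC => c0; exists c => //; exists 0%N => k _.
  by rewrite hornerC.
have -> : lead_coef (P * 'X + c%:P) = lead_coef P.
  rewrite lead_coefDl ?lead_coefMX // size_mulX // size_polyC.
  by case: (c != 0); rewrite ltnS ?size_poly_gt0 // -size_poly_gt0.
move=> /IH[e e0 [k1 h1]]; exists 1 => //.
have [k2 h2] := rat_large ((1 - c) / e); exists (maxn k1 k2) => k.
rewrite geq_max => /andP[/h1 P1 /h2].
rewrite ler_pdivrMr // => ck; rewrite hornerD hornerMX hornerC.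
have : e * k%:R <= P.[k%:R] * k%:R by apply: ler_wpM2r.
lra.
Qed.

Lemma eventually_nonneg_lead P k0 :
  (forall k, (k0 <= k)%N -> 0 <= P.[k%:R]) -> 0 <= lead_coef P.
Proof.
move=> h; rewrite leNgt; apply/negP; rewrite -oppr_gt0 -lead_coefN.
move=> /eventually_lead_pos[e e0 [k1 h1]].
have := h (maxn k0 k1) (leq_maxl _ _); have := h1 (maxn k0 k1) (leq_maxr _ _).
rewrite hornerN; lra.
Qed.

Lemma eventually_nonneg_coef P k0 (s : nat) :
  (forall k, (k0 <= k)%N -> 0 <= P.[k%:R]) -> (size P <= s.+1)%N -> 0 <= P`_s.
Proof.
move=> /eventually_nonneg_lead lP; rewrite leq_eqVlt => /orP[/eqP sP|sP].
  by move: lP; rewrite lead_coefE sP.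
by rewrite nth_default.
Qed.

Lemma eventually_eq P Q k0 :
  (forall k, (k0 <= k)%N -> P.[k%:R] = Q.[k%:R]) -> P = Q.
Proof.
move=> h; apply/eqP; rewrite -subr_eq0; apply/eqP; apply: contrapT => /eqP D0.
pose s := [seq k%:R : rat | k <- iota k0 (size (P - Q))].
have : (size s < size (P - Q)%R)%N.
  apply: max_poly_roots => //.
    apply/allP => _ /mapP[k + ->]; rewrite mem_iota => /andP[kk _].
    by apply/rootP; rewrite hornerD hornerN h // subrr.
  by rewrite map_inj_uniq ?iota_uniq // => a b /eqP; rewrite eqr_nat => /eqP.
by rewrite size_map size_iota ltnn.
Qed.

Lemma eventually_poly_uniq (h : nat -> nat -> Prop) P Q :
  (forall k r s, h k r -> h k s -> r = s) ->
  eventually_poly h P -> eventually_poly h Q -> P = Q.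
Proof.
move=> hf [k1 h1] [k2 h2]; apply: (@eventually_eq _ _ (maxn k1 k2)) => k.
rewrite geq_max => /andP[/h1[r hr ->] /h2[s hs ->]].
by rewrite (hf _ _ _ hr hs).
Qed.

(** Along an arithmetic progression of step e the values of P grow at most
    linearly, with slope a; so P has degree at most 1. *)
Lemma bounded_differences P (e : nat) (a : rat) k0 :
    (0 < e)%N -> (forall k, (k0 <= k)%N -> 0 <= P.[k%:R]) ->
    (forall k, (k0 <= k)%N -> P.[(k + e)%:R] - P.[k%:R] <= a) ->
  (size P <= 2)%N /\ e%:R * P`_1 <= a.
Proof.
move=> e0 P0 diff.
have lin m : P.[(k0 + m * e)%:R] <= P.[k0%:R] + m%:R * a.
  elim: m => [|m IH]; first by rewrite mul0n addn0 mul0r addr0.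
  have := diff (k0 + m * e)%N (leq_addr _ _).
  rewrite -addnA [(m * e + e)%N]addnC -mulSn.
  move: IH; rewrite -[m.+1%:R]natr1; lra.
pose L : {poly rat} := e%:R *: 'X + k0%:R%:P.
pose R : {poly rat} := a *: 'X + P.[k0%:R]%:P - (P \Po L).
have Rm m : 0 <= R.[m%:R].
  rewrite /R /L !(hornerE, horner_comp) /=.
  have := lin m; rewrite natrD natrM addrC [m%:R * e%:R]mulrC [m%:R * a]mulrC. lra.
have sL : size L = 2.
  rewrite size_addl size_scale ?size_polyX ?pnatr_eq0 -?lt0n //.
  by rewrite size_polyC; case: (_ != 0).
have lL : lead_coef L = e%:R.
  rewrite lead_coefDl ?lead_coefZ ?lead_coefX ?mulr1 //.
  rewrite size_scale ?size_polyX ?pnatr_eq0 -?lt0n //.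
  by rewrite size_polyC; case: (_ != 0).
have sPL : size (P \Po L) = size P by exact: size_comp_poly2.
have lPL : lead_coef (P \Po L) = lead_coef P * e%:R ^+ (size P).-1.
  by rewrite lead_coef_comp ?sL // lL.
have lP : 0 <= lead_coef P := eventually_nonneg_lead P0.
have e0r : 0 < e%:R :> rat by rewrite ltr0n.
have sA : (size (a *: 'X + P.[k0%:R]%:P : {poly rat})%R <= 2)%N.
  rewrite (leq_trans (size_polyD _ _)) // geq_max size_polyC.
  rewrite (leq_trans (size_scale_leq _ _)) ?size_polyX //.
  by case: (_ != 0).
have Rlead : 0 <= lead_coef R by apply: (@eventually_nonneg_lead _ 0%N).
have sP : (size P <= 2)%N.
  rewrite leqNgt; apply/negP => P3.
  move: Rlead; rewrite lead_coefDr ?size_polyN ?sPL ?(leq_ltn_trans sA) //.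
  rewrite lead_coefN lPL oppr_ge0 leNgt mulr_gt0 ?exprn_gt0 //.
  by rewrite lt_def lP lead_coef_eq0 -size_poly_gt0 (leq_trans _ P3).
split=> //.
have R1 : 0 <= R`_1.
  apply: (@eventually_nonneg_coef R 0%N) => //.
  rewrite (leq_trans (size_polyD _ _)) // geq_max sA size_polyN sPL //.
have PE : P = P`_1 *: 'X + (P`_0)%:P.
  apply/polyP => -[|[|k]]; rewrite coefD coefZ coefX coefC /= ?mulr0 ?mulr1 ?add0r ?addr0 //.
  by rewrite nth_default // (leq_trans sP).
move: R1; rewrite /R {2}PE comp_polyD comp_polyZ comp_polyX comp_polyC /L.
rewrite !(coefD, coefN, coefZ, coefX, coefC) /=; lra.
Qed.

End EventualPolynomials.

(** * Nakayama's lemma for powers of a maximal ideal *)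

Section Nakayama.
Variables (K : fieldType) (n : nat) (p : 'rV[K]_n.+1).
Implicit Types (f g : {mpoly K[n.+1]}) (E : seq {mpoly K[n.+1]}).

Definition generated E f : Prop :=
  exists c : nat -> {mpoly K[n.+1]}, f = \sum_(j < size E) c j * E`_j.

Lemma generated_ideal E : ideal (generated E).
Proof.
split.
- by exists (fun=> 0); rewrite big1 // => j _; rewrite mul0r.
- move=> _ _ [c ->] [d ->]; exists (fun j => c j + d j).
  by rewrite -big_split; apply: eq_bigr => j _ /=; rewrite mulrDl.
- move=> f _ [c ->]; exists (fun j => f * c j).
  by rewrite mulr_sumr; apply: eq_bigr => j _; rewrite mulrA.
Qed.

Lemma mem_generated E f : f \in E -> generated E f.
Proof.
move=> fE; have lt : (index f E < size E)%N by rewrite index_mem.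
exists (fun j => (j == index f E)%:R); rewrite (bigD1 (Ordinal lt)) //= eqxx mul1r.
rewrite nth_index // big1 ?addr0 // => j; rewrite -val_eqE /= => /negbTE ->.
by rewrite mul0r.
Qed.

Lemma maximal_ideal_generated :
  exists2 E, forall f, f \in E -> maximal_ideal p f &
    forall f, maximal_ideal p f -> generated E f.
Proof.
pose E := [seq ('X_s - (p 0 s)%:MP : {mpoly K[n.+1]}) | s <- enum 'I_n.+1]; exists E.
  by move=> _ /mapP[s _ ->] _ ->; rewrite mevalB mevalXU mevalC subrr.
have [g0 gD gM] := generated_ideal E.
pose T f := generated E (f - (f.@[p 0])%:MP).
have TM f g : T f -> T g -> T (f * g).
  move=> Tf Tg; rewrite /T mevalM mpolyCM.
  have -> : f * g - (f.@[p 0])%:MP * (g.@[p 0])%:MP =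
    f * (g - (g.@[p 0])%:MP) + (g.@[p 0])%:MP * (f - (f.@[p 0])%:MP).
    by rewrite !mulrBr [f * _%:MP]mulrC addrA subrK [X in _ = _ - X]mulrC.
  by apply: gD; apply: gM.
have TC c : T c%:MP by rewrite /T mevalC subrr.
have TD f g : T f -> T g -> T (f + g).
  by move=> Tf Tg; rewrite /T mevalD mpolyCD opprD addrACA; exact: gD.
have TX s : T 'X_s.
  rewrite /T mevalXU; apply: mem_generated; apply/mapP; exists s => //.
  by rewrite mem_enum.
have T1 : T 1 by rewrite -mpolyC1.
have Tm (m : 'X_{1..n.+1}) : T 'X_[m].
  rewrite mpolyXE_id; apply: big_ind => // s _.
  by elim: (m s) => [|k IH]; rewrite ?expr0 // exprS; exact: TM.
have Tall f : T f.
  elim/mpolyind: f => [|c m f _ _ IH]; first by rewrite -mpolyC0.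
  by apply: TD => //; rewrite -mul_mpolyC; apply: TM.
by move=> f /(_ p erefl) fp; have := Tall f; rewrite /T fp mpolyC0 subr0.
Qed.

Lemma ideal_exp_generated k :
  exists2 E, forall f, f \in E -> ideal_exp (maximal_ideal p) k f &
    forall f, ideal_exp (maximal_ideal p) k f -> generated E f.
Proof.
have [E1 E1M gen1] := maximal_ideal_generated.
elim: k => [|k [E2 E2M gen2]].
  exists [:: 1] => // f _; exists (fun=> f).
  by rewrite /= big_ord1 mulr1.
pose E := [seq e1 * e2 | e1 <- E1, e2 <- E2]; exists E.
  by move=> _ /allpairsP[[e1 e2] [/E1M ? /E2M ? ->]]; exact: ideal_mul_mem.
have [g0 gD gM] := generated_ideal E.
apply: ideal_mul_ind; first exact: generated_ideal.
move=> f g /gen1[c ->] /gen2[d ->]; rewrite mulr_suml.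
apply: big_ind => // j _; rewrite mulr_sumr; apply: big_ind => // l _.
rewrite mulrACA; apply: gM; apply: mem_generated.
by apply: allpairs_f; exact: mem_nth.
Qed.

(** The determinant trick: D is the determinant of 1 - A, where A has entries in
    the maximal ideal and expresses generators of its k-th power through
    themselves modulo L. *)
Lemma nakayama (L : set {mpoly K[n.+1]}) k : ideal L ->
    (forall f, ideal_exp (maximal_ideal p) k f ->
       exists2 g, L g & ideal_exp (maximal_ideal p) k.+1 (f - g)) ->
  exists2 D, D.@[p 0] = 1 & forall f, ideal_exp (maximal_ideal p) k f -> L (D * f).
Proof.
move=> iL step; have [E EM gen] := ideal_exp_generated k.
have [L0 LD LM] := iL.
have coefs f : ideal_exp (maximal_ideal p) k.+1 f -> exists a : nat -> {mpoly K[n.+1]},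
    (forall j, maximal_ideal p (a j)) /\ f = \sum_(j < size E) a j * E`_j.
  case=> s sM ->; rewrite big_seq.
  apply: (big_ind (fun f => exists a : nat -> {mpoly K[n.+1]},
    (forall j, maximal_ideal p (a j)) /\ f = \sum_(j < size E) a j * E`_j)).
  - exists (fun=> 0); split=> [j v _|]; first exact: meval0.
    by rewrite big1 // => j _; rewrite mul0r.
  - move=> _ _ [a [aM ->]] [b [bM ->]]; exists (fun j => a j + b j); split.
      by move=> j v ->; rewrite mevalD aM // bM // addr0.
    by rewrite -big_split; apply: eq_bigr => j _ /=; rewrite mulrDl.
  - move=> u /sM[Mu1 /gen[c ->]]; exists (fun j => u.1 * c j); split.
      by move=> j v ->; rewrite mevalM Mu1 // mul0r.
    by rewrite mulr_sumr; apply: eq_bigr => j _; rewrite mulrA.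
have /choice[a aP] : forall j : 'I_(size E), exists a : nat -> {mpoly K[n.+1]},
    (forall l, maximal_ideal p (a l)) /\ L (E`_j - \sum_(l < size E) a l * E`_l).
  move=> j; have [g Lg /coefs[a [aM aE]]] := step _ (EM _ (mem_nth 0 (ltn_ord j))).
  by exists a; split=> //; rewrite -aE subKr.
pose A := \matrix_(j < size E, l < size E) a j l.
pose e := \col_(j < size E) E`_j.
have bL j : L (((1%:M - A) *m e) j 0).
  rewrite mulmxBl mul1mx !mxE; have [_] := aP j; congr (L (_ - _)).
  by apply: eq_bigr => l _; rewrite !mxE.
exists (\det (1%:M - A)).
  rewrite -det_map_mx (_ : map_mx _ _ = 1%:M) ?det1 //.
  apply/matrixP => j l; rewrite !mxE /= mevalB.
  have [aM _] := aP j; rewrite (aM l) // subr0.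
  by case: (j == l); rewrite ?meval1 ?meval0.
move=> f /gen[c ->]; rewrite mulr_sumr; apply: big_ind => // j _.
rewrite mulrCA; apply: (LM).
have -> : \det (1%:M - A) * E`_j = (\adj (1%:M - A) *m ((1%:M - A) *m e)) j 0.
  by rewrite mulmxA mul_adj_mx mul_scalar_mx !mxE.
rewrite mxE; apply: big_ind => // l _; apply: (LM); exact: bL.
Qed.

End Nakayama.

(** * Points of a variety of positive dimension *)

Section Varieties.
Variables (K : fieldType) (n : nat) (Kinf : infinite_field K).
Implicit Types (V C : set 'rV[K]_n.+1) (f g : {mpoly K[n.+1]}) (v x : 'rV[K]_n.+1).

Lemma hilbert_function_uniq V k r s :
  hilbert_function V k r -> hilbert_function V k s -> r = s.
Proof.
by apply: quotient_dim_uniq; [exact: subspace_forms|exact: subspace_vanishing].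
Qed.

Lemma variety_not1 V : integral_variety V -> ~ vanishing_ideal V 1.
Proof.
by move=> [_ [v Vv] _] /(_ v Vv) /eqP; rewrite meval1 oner_eq0.
Qed.

(** If all the points of V were multiples of x, the evaluation at x would embed
    S_t / I(V) in K, and the Hilbert function would be bounded by 1. *)
Lemma exists_other_point V x r : integral_variety V -> V x -> has_dim V r.+1 ->
  exists2 v, V v & forall c, v <> c *: x.
Proof.
move=> [cV _ _] Vx [P [k0 hP] sP]; apply: contrapT => nex.
have Vsub v : V v -> exists c, v = c *: x.
  move=> Vv; apply: contrapT => h; apply: nex; exists v => // c E; apply: h.
  by exists c.
have [i xi] : exists i, x 0 i != 0.
  apply: contrapT => /forallNP x0; have := closed_neq0 cV Vx.
  move=> /negP; apply; apply/eqP/rowP => i; rewrite mxE.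
  by apply/eqP; apply: contrapT => /negP; exact: x0.
have bound t s : hilbert_function V t s -> (s <= 1)%N.
  move=> hs; apply: (indep_le_spans (subspace_vanishing V)
    (quotient_dim_indep (subspace_forms _ _ _) (subspace_vanishing V) hs)).
  have hX : ('X_i ^+ t : {mpoly K[n.+1]}) \is t.-homog.
    by rewrite -[_ ^+ t]mulr1 -{1}[t]subn0; apply: homog_pow_var => //; exact: dhomog1.
  exists (fun=> 'X_i ^+ t) => // f hf.
  exists (const_mx (f.@[x 0] / x 0 i ^+ t)) => v /Vsub[c ->].
  rewrite /lincomb big_ord1 mxE.
  have hh : f - (f.@[x 0] / x 0 i ^+ t) *: 'X_i ^+ t \is t.-homog.
    by apply: rpredB => //; apply: rpredZ.
  rewrite (meval_homogZ _ _ hh) mevalB mevalZ rmorphXn /= mevalXU.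
  by rewrite divfK ?expf_neq0 // subrr mulr0.
have P1 k : (k0 <= k)%N -> 0 <= P.[k%:R] <= 1.
  by move=> /hP[s /bound s1 ->]; rewrite ler0n lern1.
have lP : 0 <= lead_coef P.
  by apply: (eventually_nonneg_lead (k0 := k0)) => k /P1/andP[].
have : 0 <= lead_coef (1%:P - P).
  apply: (eventually_nonneg_lead (k0 := k0)) => k /P1/andP[_ P1k].
  by rewrite hornerD hornerN hornerC subr_ge0.
rewrite lead_coefDr ?size_polyN ?sP ?size_polyC ?oner_eq0 //.
rewrite lead_coefN oppr_ge0 => lP'.
have /eqP : lead_coef P = 0 by apply/le_anti; rewrite lP lP'.
by rewrite lead_coef_eq0 -size_poly_eq0 sP.
Qed.

End Varieties.

(** * Bezout for curves *)

Section CurveBezout.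
Variables (K : fieldType) (n : nat) (Kinf : infinite_field K).
Implicit Types (V C : set 'rV[K]_n.+1) (f g G : {mpoly K[n.+1]}).
Variables (x : 'rV[K]_n.+1) (i : 'I_n.+1).
Hypothesis xi : x 0 i != 0.

Lemma var_not_vanishing V : V x -> ~ vanishing_ideal V 'X_i.
Proof. by move=> Vx /(_ x Vx) /eqP; rewrite mevalXU (negbTE xi). Qed.

(** The ideal of V is prime and does not contain 'X_i. *)
Lemma homogenize_vanishing V N f : integral_variety V -> V x -> (msize f <= N.+1)%N ->
  vanishing_ideal (affine_chart V i) f -> vanishing_ideal V (homogenize i N f).
Proof.
move=> iV Vx fN Wf; have [cV _ _] := iV.
have /(chart_vanishing cV (homogenize_homog i N f)) :
    vanishing_ideal (affine_chart V i) (homogenize i N f).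
  by move=> v Wv; rewrite meval_homogenize ?Wf //; case: Wv.
by case/(variety_prime Kinf iV) => // /(var_not_vanishing Vx).
Qed.

(** If the dimension of the k-jets does not increase from k to k + 1, Nakayama's
    lemma shows that the k-th power of the maximal ideal is zero in the local
    ring of V at x. This ring is a domain, so that the maximal ideal is zero too
    and x is the only point of V. *)
Lemma jets_not_stationary V q k r : integral_variety V -> V x -> V q ->
    (forall c, q <> c *: x) -> hilbert_samuel V x i k r ->
  ~ hilbert_samuel V x i k.+1 r.
Proof.
move=> iV Vx Vq nq hr hr'; have [cV _ _] := iV.
have JJ f : jet_ideal x i V k f -> jet_ideal x i V k.+1 f.
  move=> Jf; apply: contrapT => nJf.
  suff : (r + 1 <= r)%N by rewrite addn1 ltnn.
  apply: (indep_le_spans (subspace_jet x i V k.+1) _ (quotient_dim_spans hr')).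
  (* The line spanned by f embeds into the kernel of the map from the
     (k + 1)-jets to the k-jets. *)
  apply: (@indep_mod_extend _ _ setT (jet_ideal x i V k)
    [set c | exists a : K, c = a%:MP] [set 0] _ f).
  - split; first by exists 0; rewrite mpolyC0.
    by move=> c _ _ [a ->] [b ->]; exists (c * a + b); rewrite mpolyCD mpolyCM mul_mpolyC.
  - exact: subspace_jet.
  - exact: jet_le.
  - move=> _ [a ->]; split=> //; rewrite mulrC.
    by case: (ideal_jet x i V k) => _ _; apply.
  - move=> _ [a ->] Ja /=; have [->|a0] := eqVneq a 0; first by rewrite mpolyC0.
    case: nJf; have -> : f = a^-1 *: (f * a%:MP) by rewrite mulrC mul_mpolyC scalerK.
    by apply: subspaceZ => //; exact: subspace_jet.
  - exact: (quotient_dim_indep (@subspaceT _ _) (subspace_jet x i V k) hr).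
  - exists (fun=> 1) => [_|c]; first by exists 1.
    rewrite /lincomb big_ord1 /= => /eqP.
    rewrite -mul_mpolyC mulr1 mpolyC_eq0 => /eqP c0.
    by apply/rowP => l; rewrite ord1 c0 mxE.
pose p := (x 0 i)^-1 *: x.
have Vp : V p by apply: closed_scale; rewrite ?invr_eq0.
have pi1 : p 0 i = 1 by rewrite mxE mulVf.
have [f Mf|D Dp DM] := @nakayama _ _ p (vanishing_ideal (affine_chart V i)) k (ideal_vanishing _).
  have [g [h [Wg Mh fE]]] := JJ _ (jet_exp V Mf); exists g => //.
  by rewrite fE addrC addKr.
have Vy s : vanishing_ideal V (cone_var x i s).
  pose y := cone_var x i s; have cy : cone_form x 1 y := cone_form_var xi s.
  have Mp : maximal_ideal p y.
    by move=> v ->; case: cy => _ /(_ (x 0 i)^-1 0 0); rewrite scale0r addr0 mul0r.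
  have Wyk := DM _ (ideal_exp_pow k Mp).
  have /(homogenize_vanishing iV Vx (leqnSn _)) Hyk := Wyk.
  have hD : homogenize i (msize D) D \is (msize D).-homog := homogenize_homog i _ D.
  have hyk : y ^+ k \is k.-homog.
    by rewrite -[k in k.-homog]mul1n; apply: dhomogMn; case: cy.
  have : vanishing_ideal V ('X_i * (homogenize i (msize D) D * y ^+ k)).
    apply: (chart_vanishing cV (dhomogM hD hyk)).
    move=> v Wv; rewrite mevalM meval_homogenize //; last by case: Wv.
    by rewrite -mevalM Wyk.
  case/(variety_prime Kinf iV) => [/(var_not_vanishing Vx)//|].
  case/(variety_prime Kinf iV).
    move=> /(_ p Vp) /eqP; rewrite meval_homogenize //.
    by rewrite Dp oner_eq0.
  elim: (k) => [/(variety_not1 iV)//|l IH].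
  by rewrite exprS => /(variety_prime Kinf iV)[|/IH].
case: (nq (q 0 i / x 0 i)); apply/rowP => s; rewrite mxE.
have /(_ q Vq) := Vy s; rewrite mevalB mevalZ !mevalXU => /eqP.
by rewrite subr_eq0 => /eqP ->; rewrite mulrAC [RHS]mulrAC [q 0 i * _]mulrC.
Qed.

Lemma hilbert_curve C a : integral_curve C -> has_degree C a ->
  exists c k0, forall t s, (k0 <= t)%N -> hilbert_function C t s -> s%:R = a%:R * t%:R + c :> rat.
Proof.
move=> [iC [P hP sP]] [Q hQ lQ].
have uniq := @hilbert_function_uniq K n C.
have PQ := eventually_poly_uniq uniq hP hQ; have [k0 h] := hP.
exists P`_0, k0 => t s /h[r hr] + hs; rewrite (uniq _ _ _ hs hr) => <-.
move: lQ; rewrite -PQ /normalized_lead lead_coefE sP /= mul1r => <-.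
by rewrite horner_coef sP big_ord_recl big_ord1 /= expr0 mulr1 expr1 addrC.
Qed.

(** The differences P(k + j + 1) - P(k) of the Hilbert-Samuel polynomial are
    bounded by the constant difference j deg C of the Hilbert function. Hence P
    has degree at most 1; it is not constant by Nakayama's lemma. *)
Lemma curve_bezout C a P j G : integral_curve C -> C x -> has_degree C a ->
    eventually_poly (hilbert_samuel C x i) P -> G \is j.-homog ->
    jet_ideal x i C j.+1 G -> ~ vanishing_ideal C G ->
  0 < normalized_lead P /\ j.+1%:R * normalized_lead P <= a%:R * j%:R.
Proof.
move=> cC Cx aC [k0 hP] hG JG nG; have [iC dC] := cC.
have [q Cq nq] := exists_other_point iC Cx dC.
have [c [t0 hC]] := hilbert_curve cC aC.
have [P1 [t1 hH] _] := dC.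
have Ppos k : (k0 <= k)%N -> 0 <= P.[k%:R] by move=> /hP[r _ ->].
have diff k : (k0 <= k)%N -> P.[(k + j.+1)%:R] - P.[k%:R] <= a%:R * j%:R.
  move=> kk; have [r hr ->] := hP _ kk.
  have [r' hr' ->] := hP _ (leq_trans kk (leq_addr j.+1 k)).
  pose t := maxn k (maxn t0 t1).
  have kt : (k <= t)%N by rewrite leq_maxl.
  have tt0 : (t0 <= t)%N by rewrite /t; lia.
  have tt1 : (t1 <= t)%N by rewrite /t; lia.
  have [s hs _] := hH _ tt1.
  have [s' hs' _] := hH _ (leq_trans tt1 (leq_addr j t)).
  have : (r' + s <= s' + r)%N.
    apply: (bezout_count xi hG JG _ kt hr hr' hs hs').
    by move=> u /(variety_prime Kinf iC)[].
  rewrite -(ler_nat rat) !natrD (hC _ _ tt0 hs) (hC _ _ (leq_trans tt0 (leq_addr j t)) hs').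
  rewrite natrD; lra.
have [sP bP] := bounded_differences (ltn0Sn j) Ppos diff.
have sP2 : size P = 2.
  apply/eqP; rewrite eqn_leq sP ltnNge; apply/negP => sP1.
  have [r hr rE] := hP _ (leqnn k0).
  have [r' hr' r'E] := hP _ (leqnSn k0).
  apply: (jets_not_stationary iC Cx Cq nq hr).
  suff -> : r = r' by [].
  apply/eqP; rewrite -(eqr_nat rat) -rE -r'E (size1_polyC sP1) !hornerC //.
rewrite /normalized_lead lead_coefE sP2 mul1r; split=> //.
have -> : P`_(2.-1) = lead_coef P by rewrite lead_coefE sP2.
rewrite lt_def (eventually_nonneg_lead Ppos) lead_coef_eq0 andbT.
by rewrite -size_poly_eq0 sP2.
Qed.

End CurveBezout.

(** * Hilbert functions of hypersurfaces *)

Section Hypersurfaces.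
Variables (K : fieldType) (n : nat).
Implicit Types (V : set 'rV[K]_n.+1) (f F G : {mpoly K[n.+1]}).

Local Notation h t := 'C(t + n, t).

Definition principal F : set {mpoly K[n.+1]} := [set f | divides F f].

Lemma subspace_principal F : subspace (principal F).
Proof.
split; first by exists 0; rewrite mulr0.
by move=> c _ _ [a ->] [b ->]; exists (c *: a + b); rewrite mulrDr scalerAr.
Qed.

Lemma pihomog_mul F e t f : F \is e.-homog ->
  pihomog mdeg (t + e) (F * f) = F * pihomog mdeg t f.
Proof.
move=> hF; pose k := maxn (msize f) t.+1.
have fk : (msize f <= k)%N by rewrite leq_maxl.
have tk : (t < k)%N by rewrite leq_maxr.
rewrite {1}(pihomog_partitionE fk) mulr_sumr raddf_sum /= (bigD1 (Ordinal tk)) //=.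
have hom s : F * pihomog mdeg s f \is (s + e).-homog.
  by rewrite addnC; apply: dhomogM => //; exact: pihomogP.
rewrite (pihomog_dE (hom t)) big1 ?addr0 // => s; rewrite -val_eqE /= => st.
by rewrite (pihomog_ne0 _ (hom s)) // eqn_add2r.
Qed.

Lemma homog_quotient F e t f : F \is e.-homog -> f \is (t + e).-homog ->
  divides F f -> exists2 q, forms t q & f = F * q.
Proof.
move=> hF hf [c fE]; exists (pihomog mdeg t c); first exact: pihomogP.
by rewrite -(pihomog_mul _ _ hF) -fE pihomog_dE.
Qed.

(** Multiplication by F embeds S_t into S_(t + e), with image the multiples of F. *)
Lemma hypersurface_dim F e t : F != 0 -> F \is e.-homog ->
  exists r, [/\ indep_mod (forms (t + e)) (principal F) r,
    spans_mod (forms (t + e)) (principal F) r & (r + h t = h (t + e))%N].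
Proof.
move=> F0 hF; have sP := subspace_principal F.
have sF a : subspace (forms a : set {mpoly K[n.+1]}) by exact: subspace_forms.
have s0 := @subspace_zero K n.+1.
have span0 : spans_mod (forms (t + e)) (principal F) (h (t + e)).
  by apply: spans_mod_sub (forms_spans K n (t + e)) => _ ->; exact: subspace0.
have [r ri rs] := spans_mod_basis sP (@subset_refl _ _) span0.
exists r; split=> //; apply/eqP; rewrite eqn_leq; apply/andP; split.
  apply: (indep_le_spans s0 _ (forms_spans K n (t + e))).
  apply: (indep_mod_extend (g := F) (sF t) sP _ _ _ ri (forms_indep K n t)).
  - by move=> _ ->; exact: subspace0.
  - move=> q Fq; split; first by rewrite addnC; exact: dhomogM.
    by exists q.
  - by move=> q _ /= /eqP; rewrite mulf_eq0 (negbTE F0) => /eqP.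
apply: (indep_le_spans s0 (forms_indep K n (t + e)) _).
apply: (spans_mod_extend (g := F) (sF _) (sF t) s0 _ _ _ rs (forms_spans K n t)).
- by move=> q Fq; rewrite /forms addnC; exact: dhomogM.
- move=> f hf /(homog_quotient hF hf)[q hq ->]; exists q => //.
  by rewrite subrr.
- by move=> q _ -> /=; rewrite mulr0.
Qed.

(** Bezout for two forms without common factor: since F is prime and does not
    divide G, multiplication by G is injective on S / (F). *)
Lemma complete_intersection_bound V F G (e f t r : nat) :
    prime_element F -> F \is e.-homog -> G \is f.-homog -> ~ divides F G ->
    vanishing_ideal V F -> vanishing_ideal V G ->
    hilbert_function V (t + e + f) r ->
  (r + h (t + e) + h (t + f) <= h (t + e + f) + h t)%N.
Proof.
move=> [F0 _ pF] hF hG nFG VF VG hr.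
have [a [ai as_ aE]] := hypersurface_dim t F0 hF.
have [b [bi bs bE]] := hypersurface_dim (t + f) F0 hF.
have le : (r + a <= b)%N.
  apply: (indep_le_spans (subspace_principal F) _ bs).
  rewrite addnAC.
  apply: (indep_mod_extend (g := G) (subspace_forms _ _ _) (subspace_vanishing V) _ _ _
    (quotient_dim_indep (subspace_forms _ _ _) (subspace_vanishing V) hr) ai).
  - by move=> _ [c ->]; case: (ideal_vanishing V) => _ _ IM; rewrite mulrC; exact: IM.
  - move=> q Fq; split; first by rewrite /forms addnC; exact: dhomogM.
    by case: (ideal_vanishing V) => _ _ IM; rewrite mulrC; exact: IM.
  - by move=> q _ /pF[].
have E : (t + f + e = t + e + f)%N by lia.
move: bE; rewrite E; lia.
Qed.

Lemma hypersurface_lower V F e t r : F != 0 -> F \is e.-homog ->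
    vanishing_ideal V `<=` principal F -> hilbert_function V (t + e) r ->
  (h (t + e) <= r + h t)%N.
Proof.
move=> F0 hF VF hr; have [a [[v va vi] _ <-]] := hypersurface_dim t F0 hF.
rewrite leq_add2r; apply: (indep_le_spans (subspace_vanishing V) _ (quotient_dim_spans hr)).
by exists v => // c /VF/vi.
Qed.

End Hypersurfaces.

(** * Jets of hypersurfaces *)

Section HypersurfaceMultiplicity.
Variables (K : fieldType) (n : nat) (Kinf : infinite_field K).
Implicit Types (V : set 'rV[K]_n.+1) (f F G : {mpoly K[n.+1]}).
Variables (x : 'rV[K]_n.+1) (i : 'I_n.+1).
Hypothesis xi : x 0 i != 0.

Local Notation h t := 'C(t + n, t).
Local Notation p := ((x 0 i)^-1 *: x).
Local Notation space_jet := (jet_ideal x i setT).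

Lemma samuel_le_hilbert V k r s :
  hilbert_samuel V x i k r -> hilbert_function V k s -> (r <= s)%N.
Proof.
move=> hr hs; apply: (indep_le_spans (subspace_vanishing V) _ (quotient_dim_spans hs)).
have [||v vh vi] := @indep_mod_onto _ _ (forms k) (jet_ideal x i V k) setT r (subspace_jet _ _ _ _).
- by move=> f _; exact: forms_jet_onto.
- exact: (quotient_dim_indep (@subspaceT _ _) (subspace_jet x i V k) hr).
by exists v => // c Vc; apply: vi; exact: vanishing_jet.
Qed.

Section Line.
Variable v : 'rV[K]_n.+1.

(** The restriction of a polynomial to the line p + s (v - p), as a polynomial in
    the parameter s. *)
Definition restrict_line : {mpoly K[n.+1]} -> {poly K} :=
  mmap (@polyC K) (fun j => (p 0 j)%:P + (v 0 j - p 0 j) *: 'X).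
HB.instance Definition _ := GRing.RMorphism.on restrict_line.

Lemma horner_restrict_line f s :
  (restrict_line f).[s] = f.@[(p + s *: (v - p)) 0].
Proof.
rewrite /restrict_line /mmap horner_sum mevalE; apply: eq_bigr => m _.
rewrite hornerM hornerC /mmap1 horner_prod; congr (_ * _); apply: eq_bigr => j _.
by rewrite horner_exp !hornerE !mxE [s * _]mulrC.
Qed.

Lemma restrict_line_exp k f : ideal_exp (maximal_ideal p) k f ->
  exists g, restrict_line f = 'X^k * g.
Proof.
elim: k f => [f _|k IH f]; first by exists (restrict_line f); rewrite mul1r.
case=> s sM ->; rewrite rmorph_sum big_seq /=.
apply: (big_ind (fun q : {poly K} => exists g : {poly K}, q = 'X^(k.+1) * g)).
- by exists 0; rewrite mulr0.
- by move=> _ _ [a ->] [b ->]; exists (a + b); rewrite mulrDr.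
move=> u /sM[Mu1 /IH[b bE]]; rewrite rmorphM /= bE.
have /factor_theorem[a] : root (restrict_line u.1) 0.
  by apply/rootP; rewrite horner_restrict_line scale0r addr0; exact: Mu1.
rewrite subr0 => ->; exists (a * b).
by rewrite exprS; ring.
Qed.

End Line.

(** In the chart, restrict f to the lines through x. The restriction has degree at
    most k because f is a form of degree k, and is divisible by the power k + 1 of
    the parameter because f vanishes to order k + 1. So f vanishes on the chart,
    hence everywhere by homogeneity. *)
Lemma forms_jet_injective k f : forms k f -> space_jet k.+1 f -> f = 0.
Proof.
move=> hf [a [b [Wa Mb fE]]].
have fv (v : 'rV[K]_n.+1) : v 0 i = 1 -> f.@[v 0] = 0.
  move=> vi; have [F [cF FE]] := expands_at_homog xi hf.
  have pi1 : p 0 i = 1 by rewrite mxE mulVf.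
  have li (s : K) : (p + s *: (v - p)) 0 i = 1.
    by move: pi1; rewrite !mxE vi => ->; rewrite subrr mulr0 addr0.
  have [g gE] := restrict_line_exp v Mb.
  have La : restrict_line v a = 0.
    by apply: Kinf => s _; rewrite horner_restrict_line Wa.
  have Lf : restrict_line v f = \poly_(l < k.+1) (F l).@[(v - p) 0].
    apply/eqP; rewrite -subr_eq0; apply/eqP/Kinf => s _.
    rewrite hornerD hornerN horner_restrict_line horner_poly FE raddf_sum /=.
    apply/eqP; rewrite subr_eq0; apply/eqP/eq_bigr => l _.
    rewrite mevalM rmorphXn /= mevalXU li expr1n mul1r.
    by case: (cF l) => _ -> _; rewrite mulrC.
  have L0 : restrict_line v f = 0.
    have E : restrict_line v f = 'X^(k.+1) * g by rewrite fE rmorphD /= La add0r gE.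
    have [g0|g0] := eqVneq g 0; first by rewrite E g0 mulr0.
    have : (size (restrict_line v f) <= k.+1)%N by rewrite Lf size_poly.
    rewrite E mulrC size_mulXn // => kg; move: g0; rewrite -size_poly_gt0; lia.
  by have := horner_restrict_line v f 1; rewrite L0 horner0 scale1r addrC subrK.
suff /eqP : 'X_i * f = 0.
  rewrite mulf_eq0 => /orP[/eqP X0|/eqP//].
  have := mevalXU (fun=> 1 : K) i; rewrite X0 meval0 => /eqP.
  by rewrite eq_sym oner_eq0.
apply: mpoly_eq0_of_meval => // u; rewrite mevalM mevalXU.
have [->|ui] := eqVneq (u i) 0; first by rewrite mul0r.
pose v : 'rV[K]_n.+1 := \row_j u j.
have -> : f.@[u] = f.@[v 0] by apply: meval_eq => j; rewrite mxE.
have -> : f.@[v 0] = v 0 i ^+ k * f.@[((v 0 i)^-1 *: v) 0].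
  by rewrite -(meval_homogZ _ _ hf) scalerKV // mxE.
by rewrite fv ?mulr0 // !mxE mulVf.
Qed.

Lemma space_jet_indep k : indep_mod setT (space_jet k.+1) (h k).
Proof.
have [v vh vi] := forms_indep K n k; exists v => // c /forms_jet_injective c0.
by apply: vi; apply: c0; apply: subspace_lincomb => //; exact: subspace_forms.
Qed.

Lemma space_jet_spans k : spans_mod setT (space_jet k.+1) (h k).
Proof.
have [v vh vs] := forms_spans K n k; exists v => // f _.
have [g hg Jg] := forms_jet_onto xi setT f (leqnn k.+1).
have [c cE] := vs _ hg; exists c.
by have -> : lincomb v c = g by apply/eqP; rewrite eq_sym -subr_eq0 cE.
Qed.

(** Among the jets of order k + 1 + mu of the affine space, those that vanish on V
    are the jets of multiples F q. As F vanishes to order mu, the jet of F q only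
    depends on the (k + 1)-jet of q, and these form a space of dimension h k. *)
Lemma samuel_lower V F mu k r : integral_variety V -> V x ->
    ideal_exp (maximal_ideal p) mu F -> vanishing_ideal V `<=` principal F ->
    hilbert_samuel V x i (k.+1 + mu) r ->
  (h (k + mu) <= r + h k)%N.
Proof.
move=> iV Vx MF VF hr.
have sQ a : subspace (space_jet a) by exact: subspace_jet.
apply: (indep_le_spans (sQ (k.+1 + mu)%N)); first by rewrite addSn; exact: space_jet_indep.
apply: (spans_mod_extend (g := F) (A2 := setT) (B2 := space_jet k.+1)
  (B := jet_ideal x i V (k.+1 + mu))) => //.
- move=> _ _ [a [b [Wa Mb ->]]].
  have /VF[q qE] := homogenize_vanishing Kinf xi iV Vx (leqnSn (msize a)) Wa.
  exists q => //; rewrite -qE addrAC; apply: subspaceD => //; last exact: jet_exp.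
  by apply: jet_affine => v vi; rewrite mevalB meval_homogenize // subrr.
- by move=> q _ Jq; rewrite addnC; apply: jet_mul => //; exact: jet_exp.
- exact: (quotient_dim_spans hr).
- exact: space_jet_spans.
Qed.

End HypersurfaceMultiplicity.

(** * Surfaces in P^3 *)

Section Surfaces.
Variables (K : fieldType) (Kinf : infinite_field K).
Implicit Types (X C : set 'rV[K]_4) (f F G : {mpoly K[4]}).

(** The Hilbert polynomial of P^3. *)
Definition forms_polynomial (t : rat) : rat := (t + 1) * (t + 2) * (t + 3) / 6.

Lemma forms_dimE t : 'C(t + 3, t)%:R = forms_polynomial t%:R.
Proof.
have : ('C(t + 3, 3) * 3`! = (t + 3) ^_ 3)%N by rewrite bin_ffact.
have -> : 'C(t + 3, 3) = 'C(t + 3, t) by rewrite -[RHS]bin_sub ?leq_addr // addKn.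
rewrite !ffactnS ffactn0 muln1 !addn3 /= => /(congr1 (fun k => k%:R : rat)).
rewrite !natrM -!natr1 /forms_polynomial => E.
have -> : 'C(t.+3, t)%:R = 'C(t.+3, t)%:R * 3`!%:R / 6 :> rat by rewrite mulfK.
by rewrite E; field.
Qed.

Lemma cubic_nonneg (a b c d : rat) k0 :
  (forall k : nat, (k0 <= k)%N -> 0 <= a * k%:R ^+ 3 + b * k%:R ^+ 2 + c * k%:R + d) -> 0 <= a.
Proof.
move=> h; pose P := Poly [:: d; c; b; a].
have -> : a = P`_3 by rewrite coef_Poly.
apply: (@eventually_nonneg_coef P k0); last exact: size_Poly.
move=> k /h; rewrite horner_Poly /= mul0r add0r; congr (_ <= _); ring.
Qed.

Lemma quadratic_nonneg (a b c : rat) k0 :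
  (forall k : nat, (k0 <= k)%N -> 0 <= a * k%:R ^+ 2 + b * k%:R + c) -> 0 <= a.
Proof.
move=> h; pose P := Poly [:: c; b; a].
have -> : a = P`_2 by rewrite coef_Poly.
apply: (@eventually_nonneg_coef P k0); last exact: size_Poly.
move=> k /h; rewrite horner_Poly /= mul0r add0r; congr (_ <= _); ring.
Qed.

Lemma linear_nonneg (a b : rat) k0 :
  (forall k : nat, (k0 <= k)%N -> 0 <= a * k%:R + b) -> 0 <= a.
Proof.
move=> h; pose P := Poly [:: b; a].
have -> : a = P`_1 by rewrite coef_Poly.
apply: (@eventually_nonneg_coef P k0); last exact: size_Poly.
move=> k /h; rewrite horner_Poly /= mul0r add0r; congr (_ <= _); ring.
Qed.

Lemma hilbert_surface X d : integral_surface X -> has_degree X d ->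
  exists b c k0, forall t, (k0 <= t)%N -> exists2 s, hilbert_function X t s &
    s%:R = d%:R / 2 * t%:R ^+ 2 + b * t%:R + c :> rat.
Proof.
move=> [iX [P hP sP]] [Q hQ lQ].
have uniq := @hilbert_function_uniq K 3 X.
have PQ := eventually_poly_uniq uniq hP hQ; have [k0 h] := hP.
exists P`_1, P`_0, k0 => t /h[r hr rE]; exists r => //.
move: lQ; rewrite -PQ /normalized_lead lead_coefE sP /= => lQ.
rewrite -rE horner_coef sP !big_ord_recl big_ord0 /= -lQ /bump /=.
have -> : 2`!%:R = 2 :> rat by [].
by field.
Qed.

Lemma bezout_surface_curve X r F G (e f t : nat) :
    prime_element F -> F \is e.-homog -> G \is f.-homog -> ~ divides F G ->
    vanishing_ideal X F -> vanishing_ideal X G ->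
    (e + f <= t)%N -> hilbert_function X t r ->
  r%:R <= e%:R * f%:R * t%:R + (e%:R * f%:R / 2) * (4 - e%:R - f%:R) :> rat.
Proof.
move=> pF hF hG nFG XF XG eft hr; pose u := (t - (e + f))%N.
have tE : t = (u + e + f)%N by rewrite /u; lia.
rewrite tE in hr *.
have := complete_intersection_bound pF hF hG nFG XF XG hr.
rewrite -(ler_nat rat) !natrD !forms_dimE /forms_polynomial !natrD.
move: (u%:R) (e%:R) (f%:R) (r%:R) => a b c s; lra.
Qed.

(** The ideal of X is nonzero, because all forms together have a cubic Hilbert
    polynomial. An element F of least degree has a prime factor in the prime
    ideal of X, which by minimality is F up to a unit. A form that vanishes on X
    and is not divisible by F would bound the quadratic Hilbert function of X by
    a linear one. *)
Lemma surface_principal X d : integral_surface X -> has_degree X d -> (0 < d)%N ->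
  exists e F, [/\ F \is e.-homog, prime_element F, vanishing_ideal X F &
    vanishing_ideal X `<=` principal F].
Proof.
move=> sX dX d0; have [iX _] := sX; have [cX _ _] := iX.
have [b [c [k0 hX]]] := hilbert_surface sX dX.
have [f0 Xf0 f0n] : exists2 f, vanishing_ideal X f & f != 0.
  apply: contrapT => I0.
  suff : 0 <= - (1 / 6 : rat) by lra.
  (* The coefficients of the Hilbert polynomial of X minus forms_polynomial. *)
  apply: (@cubic_nonneg _ (d%:R / 2 - 1) (b - 11 / 6) (c - 1) k0) => k /hX[s hs sE].
  have : ('C(k + 3, k) <= s)%N.
    apply: (indep_le_spans (subspace_vanishing X) _ (quotient_dim_spans hs)).
    have [v vh vi] := forms_indep K 3 k; exists v => // a Xa; apply: vi.
    by apply: contrapT => /eqP a0; apply: I0; exists (lincomb v a).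
  rewrite -(ler_nat rat) forms_dimE sE /forms_polynomial; lra.
have exs : exists s, `[< exists2 f, vanishing_ideal X f & f != 0 /\ msize f = s >].
  by exists (msize f0); apply/asboolP; exists f0.
case: (ex_minnP exs) => s /asboolP[f Xf [f_n0 fs]] smin.
have minimal g : vanishing_ideal X g -> g != 0 -> (s <= msize g)%N.
  by move=> Xg g0; apply: smin; apply/asboolP; exists g.
have s0 : (0 < s)%N by rewrite -fs lt0n msize_poly_eq0.
pose e := s.-1; pose F := pihomog mdeg e f.
have hF : F \is e.-homog := pihomogP mdeg e f.
have XF : vanishing_ideal X F by exact: vanishing_parts.
have F0 : F != 0.
  apply/negP => /eqP F0.
  have : mdeg (mlead f) = e by have := mlead_deg f_n0; rewrite fs /e => <-.
  have : f@_(mlead f) != 0 by rewrite mleadc_eq0.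
  move: (mlead f) => m0 fm0 m0e.
  have := congr1 (mcoeff m0) (homog_parts f); rewrite raddf_sum /=.
  have es : (e < msize f)%N by rewrite fs /e prednK.
  rewrite (bigD1 (Ordinal es)) //= -/F F0 mcoeff0 add0r big1; last first.
    move=> t te; rewrite (dhomog_nemf_coeff (pihomogP mdeg t f)) //.
    by apply: contra te => /eqP E; apply/eqP/val_inj; rewrite /= -E.
  by move/eqP; rewrite (negbTE fm0).
have sF : msize F = s.
  apply/eqP; rewrite eqn_leq minimal // andbT -[s]prednK //.
  apply/bigmax_leqP_seq => m mF _; rewrite ltnS.
  by have /dhomogP/(_ m mF) -> := hF.
have pF : prime_element F.
  have [u [l [uU lP FE]]] := factorial_mpoly F0.
  have [q ql Xq] : exists2 q, q \in l & vanishing_ideal X q.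
    move: XF; rewrite FE => /(variety_prime Kinf iX)[Xu|].
      case: (variety_not1 iX); rewrite -(mulVr uU).
      by case: (ideal_vanishing X) => _ _ h; exact: h.
    elim: (l) => [|q l' IH]; first by rewrite big_nil => /(variety_not1 iX).
    rewrite big_cons => /(variety_prime Kinf iX)[Xq|/IH[q' q'l Xq']].
      by exists q => //; rewrite mem_head.
    by exists q' => //; rewrite inE q'l orbT.
  have [q0 qU qP] := lP _ ql.
  have [g gE] : divides q F.
    rewrite FE; apply: divides_mull; rewrite (big_rem q) //=.
    by apply: divides_mulr; exists 1; rewrite mulr1.
  have g0 : g != 0 by apply: contra_neq F0; rewrite gE => ->; rewrite mulr0.
  have gU : g \is a GRing.unit.
    have : msize g = 1%N.
      have := minimal _ Xq q0; have := msizeM q0 g0; rewrite -gE sF.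
      have : (0 < msize g)%N by rewrite lt0n msize_poly_eq0.
      move: s0; clear; case: (mmeasure _ q) (mmeasure _ g) => [|a] [|b0]; lia.
    move=> /eqP/msize_poly1P[a a0 ->].
    by apply: (rmorph_unit (@mpolyC 4 K)); rewrite unitfE.
  split=> //; first by rewrite gE unitrM (negbTE qU).
  have qF a : divides q a -> divides F a.
    by case=> a' ->; exists (g^-1 * a'); rewrite gE -mulrA mulVKr.
  move=> a a' [a'' aE]; have [] : divides q a \/ divides q a'.
    by apply: qP; rewrite aE gE -mulrA; eexists.
  by move=> /qF; left.
  by move=> /qF; right.
exists e, F; split=> // g Xg; apply: ideal_of_parts => [|t].
  exact: subspace_principal.
apply: contrapT => nFG.
suff : 0 <= - (d%:R / 2) :> rat by rewrite oppr_ge0 leNgt divr_gt0 // ltr0n.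
apply: (@quadratic_nonneg _ (e%:R * t%:R - b)
  ((e%:R * t%:R / 2) * (4 - e%:R - t%:R) - c) (maxn k0 (e + t)%N)).
move=> k; rewrite geq_max => /andP[/hX[r hr rE] etk].
have := bezout_surface_curve pF hF (pihomogP mdeg t g) nFG XF (vanishing_parts Kinf t cX Xg) etk hr.
rewrite rE; lra.
Qed.

(** Compare leading coefficients: the ideal of X is contained in (F), so that the
    Hilbert function of X is at least that of the hypersurface F = 0. *)
Lemma surface_degree_le X d e F : integral_surface X -> has_degree X d ->
    F != 0 -> F \is e.-homog -> vanishing_ideal X `<=` principal F ->
  (e <= d)%N.
Proof.
move=> sX dX F0 hF XF; have [b [c [k0 hX]]] := hilbert_surface sX dX.
rewrite -(ler_nat rat) -subr_ge0.
suff : 0 <= d%:R / 2 - e%:R / 2 :> rat by lra.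
(* The Hilbert polynomial of X at t + e, minus the difference of the values of
   forms_polynomial at t + e and at t, as a polynomial in t. *)
apply: (@quadratic_nonneg _ (d%:R * e%:R + b - e%:R ^+ 2 / 2 - 2 * e%:R)
  (d%:R * e%:R ^+ 2 / 2 + b * e%:R + c - (e%:R ^+ 3 + 6 * e%:R ^+ 2 + 11 * e%:R) / 6) k0).
move=> t t0; have [r hr rE] := hX _ (leq_trans t0 (leq_addr e t)).
have := hypersurface_lower F0 hF XF hr.
rewrite -(ler_nat rat) natrD !forms_dimE rE /forms_polynomial !natrD.
move: (t%:R) (e%:R) (d%:R) => u v w; lra.
Qed.

(** The jets of X at x grow at least like those of an equation of order mu, and
    at most like the Hilbert function of X. The latter bound shows that the
    Hilbert-Samuel polynomial has degree at most 2, so that its coefficient of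
    degree 2 determines the multiplicity unless mu = 0. *)
Lemma surface_multiplicity_ge X x i P d m mu F : integral_surface X -> has_degree X d ->
    X x -> x 0 i != 0 -> eventually_poly (hilbert_samuel X x i) P ->
    normalized_lead P = m%:R -> ideal_exp (maximal_ideal ((x 0 i)^-1 *: x)) mu F ->
    vanishing_ideal X `<=` principal F ->
  (mu <= m)%N.
Proof.
move=> sX dX Xx xi [k1 hP] mP MF XF; have [iX _] := sX.
have [b [c [k0 hX]]] := hilbert_surface sX dX.
have P0 k : (k1 <= k)%N -> 0 <= P.[k%:R] by move=> /hP[r _ ->].
have lP := eventually_nonneg_lead P0.
have P3 : (size P <= 3)%N.
  rewrite leqNgt; apply/negP => P4.
  pose Q : {poly rat} := Poly [:: c; b; d%:R / 2].
  have : 0 <= lead_coef (Q - P).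
    apply: (@eventually_nonneg_lead _ (maxn k0 k1)) => k.
    rewrite geq_max => /andP[/hX[s hs sE] /hP[r hr rE]].
    rewrite hornerD hornerN rE horner_Poly /= mul0r add0r.
    have := samuel_le_hilbert xi hr hs; rewrite -(ler_nat rat) sE; lra.
  have sQ : (size Q < size P)%N by apply: leq_ltn_trans (size_Poly _) _.
  rewrite lead_coefDr ?size_polyN // lead_coefN oppr_ge0 => lP'.
  have /eqP : lead_coef P = 0 by apply/le_anti; rewrite lP lP'.
  by rewrite lead_coef_eq0 -size_poly_eq0; case: (size P) P4.
have PE a : P.[a] = P`_2 * a ^+ 2 + P`_1 * a + P`_0.
  rewrite (@horner_coef_wide _ 3) // !big_ord_recl big_ord0 /= /bump /=; ring.
(* The coefficients are those of P (k + 1 + mu) minus the difference of the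
   values of forms_polynomial at k + mu and at k, as polynomials in k. *)
have Pmu : 0 <= P`_2 - mu%:R / 2.
  apply: (@quadratic_nonneg _ (2 * P`_2 * (1 + mu%:R) + P`_1 - mu%:R ^+ 2 / 2 - 2 * mu%:R)
    (P`_2 * (1 + mu%:R) ^+ 2 + P`_1 * (1 + mu%:R) + P`_0 -
      (mu%:R ^+ 3 + 6 * mu%:R ^+ 2 + 11 * mu%:R) / 6) k1).
  move=> k kk; have [|r hr rE] := hP (k.+1 + mu)%N; first by lia.
  have := samuel_lower Kinf xi iX Xx MF XF hr.
  rewrite -(ler_nat rat) natrD !forms_dimE -rE PE /forms_polynomial !natrD -[k.+1%:R]natr1.
  move: (k%:R) (mu%:R) (P`_2) (P`_1) (P`_0) => u v p2 p1 p0; lra.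
have [->//|mu0] := posnP mu.
have P2 : 0 < P`_2.
  have : 0 < mu%:R :> rat by rewrite ltr0n.
  lra.
have sP : size P = 3.
  apply/eqP; rewrite eqn_leq P3 ltnNge; apply/negP => sP2.
  by move: P2; rewrite nth_default // ltxx.
move: mP; rewrite /normalized_lead lead_coefE sP /=.
have -> : 2`!%:R = 2 :> rat by [].
by rewrite -(ler_nat rat) => <-; lra.
Qed.

End Surfaces.

(** * Truncations of the equation and curves on the surface *)

Section SurfacePoint.
Variables (K : fieldType) (Kinf : infinite_field K).

Section Truncation.
Variables (n : nat) (x : 'rV[K]_n.+1) (i : 'I_n.+1).
Implicit Types (V : set 'rV[K]_n.+1).
Variables (e : nat) (F : {mpoly K[n.+1]}) (part : nat -> {mpoly K[n.+1]}).
Hypothesis Fexp : expands_at x i e F part.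

Definition truncation (j : nat) : {mpoly K[n.+1]} :=
  \sum_(l < j.+1) 'X_i ^+ (j - l) * part l.

Lemma truncation_homog j : truncation j \is j.-homog.
Proof.
case: Fexp => cF _; apply: rpred_sum => l _; apply: homog_pow_var; first exact: leq_ord.
by case: (cF l).
Qed.

Lemma truncation0 : truncation 0 = part 0.
Proof. by rewrite /truncation big_ord1 subnn expr0 mul1r. Qed.

Lemma truncationS j : truncation j.+1 = 'X_i * truncation j + part j.+1.
Proof.
rewrite /truncation big_ord_recr /= subnn expr0 mul1r mulr_sumr; congr (_ + _).
by apply: eq_bigr => l _ /=; rewrite subSn ?leq_ord // exprS mulrA.
Qed.

Lemma truncation_full : truncation e = F.
Proof. by case: Fexp => _ ->. Qed.

(** On the chart w = 1 the truncation in degree j is congruent to F minus the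
    terms of F of order greater than j, and F vanishes on V. *)
Lemma truncation_jet V j : (j <= e)%N -> vanishing_ideal V F ->
  jet_ideal x i V j.+1 (truncation j).
Proof.
move=> je VF; case: Fexp => cF FE; have sJ := subspace_jet x i V j.+1.
pose T := \sum_(l < j.+1) 'X_i ^+ (e - l) * part l.
have -> : truncation j = truncation j - T + T by rewrite subrK.
apply: subspaceD => //.
  rewrite /truncation -sumrB; apply: subspace_sum => // l _.
  apply: jet_affine => v vi; rewrite mevalB !mevalM !rmorphXn /= mevalXU vi.
  by rewrite !expr1n subrr.
have -> : T = F - \sum_(l < e.+1 | ~~ (l < j.+1)%N) 'X_i ^+ (e - l) * part l.
  rewrite FE (bigID (fun l : 'I_e.+1 => (l < j.+1)%N)) /= addrK.
  rewrite /T (big_ord_widen e.+1 (fun l => 'X_i ^+ (e - l) * part l)) //.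
apply: subspaceB => //; first exact: vanishing_jet.
apply: subspace_sum => // l; rewrite -leqNgt => jl.
case: (ideal_jet x i V j.+1) => _ _; apply; apply: jet_exp.
by apply: (ideal_exp_le jl); case: (cF l).
Qed.

(** Consecutive truncations differ by one term: part l.+1 is
    truncation l.+1 - 'X_i * truncation l. *)
Lemma truncations_vanish V : (forall j, (j <= e)%N -> vanishing_ideal V (truncation j)) ->
  forall l, (l <= e)%N -> vanishing_ideal V (part l).
Proof.
move=> VG [|l] le; first by rewrite -truncation0; exact: VG.
have -> : part l.+1 = truncation l.+1 - 'X_i * truncation l by rewrite truncationS addrC addKr.
apply: (subspaceB (subspace_vanishing V)); first exact: VG.
by case: (ideal_vanishing V) => _ _; apply; apply: VG; exact: ltnW.
Qed.

Lemma parts_vanish_on_line (q : 'rV[K]_n.+1) s t : (forall l, (l <= e)%N -> (part l).@[q 0] = 0) ->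
  F.@[(s *: x + t *: q) 0] = 0.
Proof.
move=> Fq; case: Fexp => cF ->; rewrite raddf_sum big1 // => l _ /=.
by rewrite mevalM; case: (cF l) => _ -> _; rewrite Fq ?leq_ord // !mulr0.
Qed.

End Truncation.

Lemma line_through n (x q : 'rV[K]_n.+1) : x != 0 -> (forall c, q <> c *: x) ->
  exists L, [/\ is_line L, L x & forall v, L v -> v != 0 /\ exists s t, v = s *: x + t *: q].
Proof.
move=> x0 nq; pose A : 'M_(1 + 1, n.+1) := col_mx x q.
have mulA (u : 'rV_(1 + 1)) : u *m A = lsubmx u 0 0 *: x + rsubmx u 0 0 *: q.
  rewrite -{1}[u]hsubmxK mul_row_col {1}[lsubmx u]mx11_scalar {1}[rsubmx u]mx11_scalar.
  by rewrite !mul_scalar_mx.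
exists [set v | v != 0 /\ (v <= A)%MS]; split.
- exists A => //; apply/eqP; rewrite -[_ == _]/(row_free A) -kermx_eq0.
  apply/rowV0P => u /sub_kermxP; rewrite mulA => E.
  have u1 : rsubmx u 0 0 = 0.
    apply: contrapT => /eqP u1; apply: (nq (- (rsubmx u 0 0)^-1 * lsubmx u 0 0)).
    move/eqP: E; rewrite addr_eq0 -scalerA => /eqP ->.
    by rewrite scalerN scaleNr opprK scalerK.
  move/eqP: E; rewrite u1 scale0r addr0 scaler_eq0 (negbTE x0) orbF => /eqP u0.
  rewrite -[u]hsubmxK [lsubmx u]mx11_scalar [rsubmx u]mx11_scalar u0 u1.
  by rewrite !raddf0 row_mx0.
- split=> //; apply/submxP; exists (row_mx 1%:M 0).
  by rewrite mul_row_col mul1mx mul0mx addr0.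
- move=> v [v0 /submxP[u vE]]; split=> //.
  by rewrite vE mulA; do 2!eexists.
Qed.

Variables (X : set 'rV[K]_4) (d m : nat) (x : 'rV[K]_4).
Hypotheses (X_surface : integral_surface X) (X_degree : has_degree X d)
  (d_gt0 : (0 < d)%N) (X_x : X x) (X_mult : has_multiplicity X x m)
  (X_no_line : forall L : set 'rV[K]_4, is_line L -> L x -> ~ (L `<=` X)).

(** The terms of F are equations of cones with vertex x, so that they vanish on
    the line joining x to q as soon as they vanish at q. *)
Lemma no_line_vanishing i e F part (q : 'rV[K]_4) :
    expands_at x i e F part -> vanishing_ideal X `<=` principal F ->
    (forall c, q <> c *: x) -> (forall l, (l <= e)%N -> (part l).@[q 0] = 0) ->
  False.
Proof.
move=> Fexp XF nq Fq; have [[cX _ _] _] := X_surface.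
have [L [lL Lx Lv]] := line_through (closed_neq0 cX X_x) nq.
apply: (X_no_line lL Lx) => v /Lv[v0 [s [t vE]]].
apply: closedE => // f /XF[g ->].
by rewrite mevalM vE (parts_vanish_on_line Fexp) // mul0r.
Qed.

Section Curve.
Variables (C : set 'rV[K]_4) (a b : nat).
Hypotheses (C_curve : integral_curve C) (CX : C `<=` X) (C_x : C x)
  (C_degree : has_degree C a) (C_mult : has_multiplicity C x b).

(** If all the truncations of the equation F of X in degrees below deg F vanished
    on C, so would all the terms of F, and X would contain the line joining x to
    another point of C. So some truncation, of degree j < deg F <= d, does not
    vanish on C, and Bezout gives (j + 1) b <= j a. *)
Lemma curve_degree_multiplicity : (0 < b)%N /\ (d * b <= (d - 1) * a)%N.
Proof.
have [e [F [hF [F0 _ _] XF XprF]]] := surface_principal Kinf X_surface X_degree d_gt0.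
have ed := surface_degree_le X_surface X_degree F0 hF XprF.
have [i [xi [P hP lP]]] := C_mult.
have [part Fexp] := expands_at_homog xi hF.
have CF : vanishing_ideal C F by move=> v /CX; exact: XF.
have [iC dC] := C_curve; have [q Cq nq] := exists_other_point iC C_x dC.
have [j [je nCG]] : exists j, (j < e)%N /\ ~ vanishing_ideal C (truncation i part j).
  apply: contrapT => /forallNP h.
  apply: (no_line_vanishing Fexp XprF nq) => l le; move: q Cq {nq}.
  apply: (@truncations_vanish _ i e part C) => // j; rewrite leq_eqVlt => /orP[/eqP ->|je].
    by rewrite (truncation_full Fexp).
  by apply: contrapT => nG; apply: (h j).
have [] := curve_bezout Kinf xi C_curve C_x C_degree hP (truncation_homog Fexp j)
  (truncation_jet Fexp (ltnW je) CF) nCG.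
rewrite lP ltr0n -!natrM ler_nat => b0 bez; split=> //.
have ab : (b <= a)%N.
  rewrite leqNgt; apply/negP => ab.
  have : (a * j <= b * j)%N by apply: leq_mul => //; exact: ltnW.
  lia.
have /subnK aE := ab; move: bez; rewrite -aE; set c := (a - b)%N => bez.
have : (b <= j * c)%N by lia.
have : (j * c <= (d - 1) * c)%N by apply: leq_mul => //; lia.
have : ((d - 1) * b + b = d * b)%N by rewrite addnC -mulSn subn1 prednK.
rewrite mulnDr; lia.
Qed.

(** The lowest nonzero term of F has degree mu <= m and is itself a truncation. If
    it did not vanish on C, Bezout would give (mu + 1) b <= mu a, against the
    assumption. So C lies on the complete intersection of F and of this term,
    whose degree is at most d m. The term is not divisible by F, since otherwise
    F would consist of it alone, and X would be a cone with vertex x. *)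
Lemma curve_degree_bound : (m * a < m.+1 * b)%N -> (a <= m * d)%N.
Proof.
move=> ratio.
have [e [F [hF pF XF XprF]]] := surface_principal Kinf X_surface X_degree d_gt0.
have F0 : F != 0 by case: pF.
have ed := surface_degree_le X_surface X_degree F0 hF XprF.
have [i [xi [P hP lP]]] := C_mult.
have [part Fexp] := expands_at_homog xi hF; have [cpart FE] := Fexp.
have CF : vanishing_ideal C F by move=> v /CX; exact: XF.
have ex_mu : exists l, (l <= e)%N && (part l != 0).
  apply: contrapT => /forallNP h; case/eqP: F0; rewrite FE big1 // => l _.
  suff -> : part l = 0 by rewrite mulr0.
  by apply: contrapT => /eqP pl; apply: (h l); rewrite leq_ord pl.
case: (ex_minnP ex_mu) => mu /andP[mue pmu0] mumin.
have part0 l : (l < mu)%N -> part l = 0.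
  move=> lmu; apply: contrapT => /eqP pl; have := mumin l.
  by rewrite pl (leq_trans (ltnW lmu) mue) leqNgt lmu => /(_ isT).
have mum : (mu <= m)%N.
  have [i0 [xi0 [P0 hP0 lP0]]] := X_mult.
  apply: (surface_multiplicity_ge Kinf X_surface X_degree X_x xi0 hP0 lP0 _ XprF).
  have iM := ideal_exp_ideal (maximal_ideal ((x 0 i0)^-1 *: x)) mu.
  rewrite FE; apply: subspace_sum => [|l _]; first exact: ideal_subspace.
  have [lmu|mul] := ltnP l mu; first by rewrite part0 // mulr0; case: iM.
  case: iM => _ _; apply; apply: (ideal_exp_le mul).
  by case: (cpart l).
have truncE : truncation i part mu = part mu.
  rewrite /truncation big_ord_recr /= subnn expr0 mul1r big1 ?add0r // => l _.
  by rewrite part0 ?mulr0.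
have Cpart : vanishing_ideal C (part mu).
  apply: contrapT => nC; rewrite -truncE in nC.
  have [_] := curve_bezout Kinf xi C_curve C_x C_degree hP (truncation_homog Fexp mu)
    (truncation_jet Fexp mue CF) nC.
  rewrite lP -!natrM ler_nat => bez.
  have [b0 _] := curve_degree_multiplicity.
  have ab : (b <= a)%N.
    rewrite leqNgt; apply/negP => ab.
    have : (a * mu <= b * mu)%N by apply: leq_mul => //; exact: ltnW.
    lia.
  have /subnK aE := ab; move: ratio bez; rewrite -aE; set c' := (a - b)%N => ratio bez.
  have : (mu * c' <= m * c')%N by apply: leq_mul.
  rewrite mulnDr in ratio; rewrite mulnDl in bez; lia.
have hpart : part mu \is mu.-homog by case: (cpart mu).
have npart : ~ divides F (part mu).
  case=> g gE; have g0 : g != 0 by apply: contra_neq pmu0; rewrite gE => ->; rewrite mulr0.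
  have sz (f : {mpoly K[4]}) t : f != 0 -> f \is t.-homog -> msize f = t.+1.
    by move=> f0 /dhomogP hf; rewrite -mlead_deg // hf ?mlead_supp.
  have := msizeM F0 g0; rewrite -gE (sz _ _ pmu0 hpart) (sz _ _ F0 hF) addSn /= => muE.
  have emu : mu = e.
    have : (0 < msize g)%N by rewrite lt0n msize_poly_eq0.
    move: mue muE; clear; case: (mmeasure _ g) => [|k]; lia.
  have [[iX _] dX] := (X_surface, X_surface.2); have [q Xq nq] := exists_other_point iX X_x dX.
  apply: (no_line_vanishing Fexp XprF nq) => l; rewrite leq_eqVlt => /orP[/eqP ->|le].
    have Fmu : F = part mu by rewrite -truncE emu (truncation_full Fexp).
    by rewrite -emu -Fmu; exact: XF.
  by rewrite part0 ?meval0 // emu.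
have [c [k0 hC]] := hilbert_curve C_curve C_degree.
have [_ [P1 [k1 hP1] _]] := C_curve.
have : (a <= e * mu)%N.
  rewrite -(ler_nat rat) -subr_ge0 natrM.
  apply: (@linear_nonneg _ ((e%:R * mu%:R / 2) * (4 - e%:R - mu%:R) - c)
    (maxn k0 (maxn k1 (e + mu)))).
  move=> k; rewrite !geq_max => /and3P[k0k k1k emuk].
  have [s hs _] := hP1 _ k1k.
  have := bezout_surface_curve pF hF hpart npart CF Cpart emuk hs.
  rewrite (hC _ _ k0k hs); lra.
move=> /leq_trans; apply; rewrite mulnC; exact: leq_mul.
Qed.

End Curve.
End SurfacePoint.

(** * Ratios of degree and multiplicity *)

Section Arithmetic.
Implicit Types (R : numFieldType) (a b c d : nat).

Lemma ler_ratio R a b c d : (0 < b)%N -> (0 < d)%N ->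
  (a%:R / b%:R <= c%:R / d%:R :> R) = (a * d <= c * b)%N.
Proof.
by move=> b0 d0; rewrite ler_pdivrMr ?ltr0n // mulrAC ler_pdivlMr ?ltr0n // -!natrM ler_nat.
Qed.

Lemma ltr_ratio R a b c d : (0 < b)%N -> (0 < d)%N ->
  (a%:R / b%:R < c%:R / d%:R :> R) = (a * d < c * b)%N.
Proof.
by move=> b0 d0; rewrite ltr_pdivrMr ?ltr0n // mulrAC ltr_pdivlMr ?ltr0n // -!natrM ltr_nat.
Qed.

(** The first bound forces b < a, so that only a = 2, b = 1 has to be excluded. *)
Lemma degree_ge3 a b d m : (0 < b)%N -> (0 < m)%N -> (0 < d)%N ->
  (d * b <= (d - 1) * a)%N -> (m * a < m.+1 * b)%N -> (3 <= a)%N.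
Proof.
move=> b0 m0 d0 low high; rewrite ltnNge; apply/negP => a2.
have ba : (b < a)%N.
  rewrite ltnNge; apply/negP => ab.
  have : ((d - 1) * a <= (d - 1) * b)%N by apply: leq_mul.
  have : ((d - 1) * b + b = d * b)%N by rewrite addnC -mulSn subn1 prednK.
  lia.
have aE : a = 2 by lia.
have bE : b = 1 by lia.
move: high; rewrite aE bE; lia.
Qed.

End Arithmetic.

(** Only finitely many pairs are good. This is why the infimum that defines a
    small Seshadri constant is attained. *)
Lemma least_ratio (R : realFieldType) (good : nat -> nat -> Prop) N :
    (forall a b, good a b -> (a <= N)%N /\ (b <= N)%N) -> (exists a b, good a b) ->
  exists a b, good a b /\
    forall a' b', good a' b' -> a%:R / b%:R <= a'%:R / b'%:R :> R.
Proof.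
move=> bnd [a0 [b0 g0]].
have ord a : (a <= N)%N -> {i : 'I_N.+1 | i = a :> nat}.
  by rewrite -ltnS => aN; exists (Ordinal aN).
have [a0N b0N] := bnd _ _ g0.
have [[i iE] [j jE]] := (ord _ a0N, ord _ b0N).
pose P (u : 'I_N.+1 * 'I_N.+1) := `[< good u.1 u.2 >].
pose ratio (u : 'I_N.+1 * 'I_N.+1) : R := (u.1 : nat)%:R / (u.2 : nat)%:R.
have Pij : P (i, j) by apply/asboolP; rewrite /= iE jE.
case: (@arg_minP _ _ _ (i, j) P ratio Pij) => u /asboolP gu umin.
exists u.1, u.2; split=> // a b gab; have [aN bN] := bnd _ _ gab.
have [[k kE] [l lE]] := (ord _ aN, ord _ bN).
have := umin (k, l); rewrite /ratio /= kE lE; apply.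
by apply/asboolP; rewrite /= kE lE.
Qed.

Theorem proposition1p3 (R : realType) (X : set 'rV[R[i]]_4) (d m : nat)
    (x : 'rV[R[i]]_4)
    (X_surface : integral_surface X)
    (X_degree : has_degree X d)
    (d_ge3 : (3 <= d)%N)
    (X_x : X x)
    (X_mult : has_multiplicity X x m)
    (X_no_line : forall L : set 'rV[R[i]]_4, is_line L -> L x -> ~ (L `<=` X)) :
  (EFin (d%:R / (d%:R - 1)) <= seshadri_O1 X x)%O
  /\
  ((seshadri_O1 X x < EFin ((m%:R + 1) / m%:R))%O ->
   exists a b : int,
     [/\ seshadri_O1 X x = EFin (a%:~R / b%:~R),
         (3 <= a)%R, (a <= m%:Z * d%:Z)%R,
         (m%:R * a%:~R / (m%:R + 1) < b%:~R :> R)%R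
       & (b%:~R <= a%:~R * (d%:R - 1) / d%:R :> R)%R]).
Proof.
have Kinf : infinite_field (R[i] : fieldType) by exact: infinite_numField.
have d0 : (0 < d)%N by apply: leq_trans d_ge3.
have d1 : (0 < d - 1)%N by rewrite subn_gt0; apply: leq_trans d_ge3.
have dE : d%:R - 1 = (d - 1)%:R :> R by rewrite natrB.
pose good a b := (exists C, [/\ integral_curve C, C `<=` X, C x, has_degree C a
  & has_multiplicity C x b]) /\ (m * a < m.+1 * b)%N.
have low C a b : integral_curve C -> C `<=` X -> C x -> has_degree C a ->
    has_multiplicity C x b -> (0 < b)%N /\ (d * b <= (d - 1) * a)%N.
  move=> cC CX Cx aC bC.
  exact: (curve_degree_multiplicity Kinf X_surface X_degree d0 X_x X_no_line cC CX Cx aC bC).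
split.
  apply/ereal_infP => _ [C [a [b [cC [CX Cx] aC bC ->]]]].
  have [b0 ab] := low _ _ _ cC CX Cx aC bC.
  by rewrite lee_fin dE ler_ratio // [(a * _)%N]mulnC.
move=> lt_inf.
have m0 : (0 < m)%N.
  rewrite lt0n; apply/eqP => mz; move: lt_inf; rewrite mz invr0 mulr0 ltNge => /negP; apply.
  apply/ereal_infP => _ [C [a [b [_ _ _ _ ->]]]].
  by rewrite lee_fin divr_ge0 ?ler0n.
have mE : (m%:R + 1) / m%:R = m.+1%:R / m%:R :> R by rewrite natr1.
have ratioE a b : (0 < b)%N -> (a%:R / b%:R < (m%:R + 1) / m%:R :> R) = (m * a < m.+1 * b)%N.
  by move=> b0; rewrite mE ltr_ratio // mulnC.
have good_bound a b : good a b -> [/\ (0 < b)%N, (d * b <= (d - 1) * a)%N,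
    (m * a < m.+1 * b)%N & (a <= m * d)%N].
  move=> [[C [cC CX Cx aC bC]] ratio]; have [b0 ab] := low _ _ _ cC CX Cx aC bC.
  split=> //.
  exact: (curve_degree_bound Kinf X_surface X_degree d0 X_x X_mult X_no_line cC CX Cx aC bC).
have [a [b [gab abmin]]] : exists a b, good a b /\
    forall a' b', good a' b' -> a%:R / b%:R <= a'%:R / b'%:R :> R.
  apply: (@least_ratio _ _ (m * d)%N).
    move=> a b /good_bound[b0 ab _ amd]; split=> //; apply: leq_trans amd.
    rewrite -(leq_pmul2l d0); apply: (leq_trans ab).
    by rewrite leq_mul2r leq_subr orbT.
  have [e [C [a [b [cC [CX Cx] aC bC ->]]]] elt] := ereal_inf_lt lt_inf.
  have [b0 ab] := low _ _ _ cC CX Cx aC bC.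
  exists a, b; split; first by exists C.
  by move: elt; rewrite lte_fin ratioE.
have [b0 ab ratio amd] := good_bound _ _ gab.
exists a%:Z, b%:Z; rewrite -!pmulrn; split.
- apply/le_anti/andP; split.
    apply: ereal_inf_lbound.
    by case: gab => -[C [cC CX Cx aC bC]] _; exists C, a, b.
  apply/ereal_infP => _ [C [a' [b' [cC [CX Cx] aC bC ->]]]].
  have [b'0 _] := low _ _ _ cC CX Cx aC bC.
  rewrite lee_fin; have [lt|ge] := ltP (a'%:R / b'%:R : R) ((m%:R + 1) / m%:R).
    by apply: abmin; split; [exists C|rewrite -ratioE].
  by apply: le_trans ge; apply: ltW; rewrite ratioE.
- by rewrite lez_nat; exact: (degree_ge3 b0 m0 d0 ab ratio).
- by rewrite -PoszM lez_nat.
- by rewrite natr1 ltr_pdivrMr ?ltr0n // -!natrM ltr_nat mulnC [(b * _)%N]mulnC // mulnC.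
- by rewrite dE ler_pdivlMr ?ltr0n // -!natrM ler_nat mulnC [(a * _)%N]mulnC.
Qed.
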